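(* The problem Balanced Cluster Editing (BCE), parameterized by $k$, admits a kernel with $\mathcal{O}(k^3)$ vertices: there is a polynomial-time algorithm that, given an instance $(G,k,\eta)$ of BCE, outputs an equivalent instance $(G',k',\eta')$ of BCE (a yes-instance if and only if $(G,k,\eta)$ is) with $|V(G')|=\mathcal{O}(k^3)$ and $k'\le k$.
   Context: All graphs are finite and simple. A cluster graph is a graph in which every connected component is a clique. For a non-negative integer $\eta$, a graph is $\eta$-balanced if for any two connected components $H,H'$ we have $\big||V(H)|-|V(H')|\big|\le\eta$. For $F\subseteq\binom{V(G)}{2}$, $G\triangle F$ is the graph with vertex set $V(G)$ and edge set the symmetric difference $E(G)\triangle F$. Balanced Cluster Editing (BCE): given a graph $G$ and non-negative integers $k,\eta$, decide whether there is $F\subseteq\binom{V(G)}{2}$ with $|F|\le k$ such that $G\triangle F$ is an $\eta$-balanced cluster graph. *)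

(* Defs.v *)
From mathcomp Require Import all_boot all_order all_algebra.

Set Implicit Arguments.
Unset Strict Implicit.
Unset Printing Implicit Defensive.

Definition pairs (V : finType) : {set {set V}} := [set e : {set V} | #|e| == 2].

Record graph (V : finType) := Graph {
  edges : {set {set V}};
  edges_pairs : edges \subset pairs V
}.

(* Irreflexive, since an edge has exactly two elements. *)
Definition adj (V : finType) (G : graph V) : rel V :=
  fun x y => [set x; y] \in edges G.

Definition component_of (V : finType) (G : graph V) (x : V) : {set V} :=
  [set y | connect (adj G) x y].

Definition components (V : finType) (G : graph V) : {set {set V}} :=
  [set component_of G x | x : V].

Definition clique (V : finType) (G : graph V) (A : {set V}) : Prop :=
  forall x y, x \in A -> y \in A -> x != y -> adj G x y.

Definition cluster_graph (V : finType) (G : graph V) : Prop :=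
  forall H, H \in components G -> clique G H.

Definition balanced (V : finType) (eta : nat) (G : graph V) : Prop :=
  forall H H', H \in components G -> H' \in components G ->
    (absz (Posz #|H| - Posz #|H'|)%R <= eta)%N.

Definition symdiff (T : finType) (A B : {set T}) : {set T} :=
  (A :\: B) :|: (B :\: A).

Lemma symdiff_subset (T : finType) (A B C : {set T}) :
  A \subset C -> B \subset C -> symdiff A B \subset C.
Proof.
move=> sAC sBC; rewrite subUset.
by rewrite (subset_trans (subsetDl _ _) sAC) (subset_trans (subsetDl _ _) sBC).
Qed.

Definition edit (V : finType) (G : graph V) (F : {set {set V}})
    (FP : F \subset pairs V) : graph V :=
  Graph (symdiff_subset (edges_pairs G) FP).

Record instance := Instance {
  nverts : nat;
  igraph : graph 'I_nverts;
  budget : nat;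
  imbalance : nat
}.

Definition yes_instance (I : instance) : Prop :=
  exists (F : {set {set 'I_(nverts I)}}) (FP : F \subset pairs 'I_(nverts I)),
    [/\ #|F| <= budget I,
        cluster_graph (edit (igraph I) FP) &
        balanced (imbalance I) (edit (igraph I) FP)].

Definition bitlen (m : nat) : nat := (trunc_log 2 m).+1.

(* Adjacency matrix, with n, k and eta written in binary. *)
Definition isize (I : instance) : nat :=
  nverts I * nverts I + bitlen (nverts I) + bitlen (budget I)
  + bitlen (imbalance I).

(* Polynomial time is measured on a random access machine with scalar         *)
(* registers, an unbounded memory addressed indirectly, unit cost, and only   *)
(* addition and truncated subtraction as arithmetic. There is deliberately no *)
(* multiplication: bit lengths then grow by at most one per step, so that     *)
(* unit-cost time is polynomially equivalent to Turing machine time.          *)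
Record state := State { regs : nat -> nat; memory : nat -> nat }.

Definition upd (f : nat -> nat) (a v : nat) : nat -> nat :=
  fun b => if b == a then v else f b.

Inductive cmd : Type :=
| Skip
| Const (r c : nat)
| Add (r a b : nat)
| Sub (r a b : nat)
| Read (r a : nat)
| Write (a r : nat)
| Seq (p q : cmd)
| If (r : nat) (p q : cmd)
| While (r : nat) (p : cmd).

Definition set_reg (s : state) (r v : nat) : state :=
  State (upd (regs s) r v) (memory s).

Definition set_mem (s : state) (a v : nat) : state :=
  State (regs s) (upd (memory s) a v).

(* [exec p s t s']: started in s, p halts in s' after exactly t steps. The    *)
(* operands of Add, Sub, Read and Write are register numbers; tests are for   *)
(* a nonzero register.                                                        *)
Inductive exec : cmd -> state -> nat -> state -> Prop :=
| exec_skip s : exec Skip s 1 s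
| exec_const s r c : exec (Const r c) s 1 (set_reg s r c)
| exec_add s r a b :
    exec (Add r a b) s 1 (set_reg s r (regs s a + regs s b))
| exec_sub s r a b :
    exec (Sub r a b) s 1 (set_reg s r (regs s a - regs s b))
| exec_read s r a : exec (Read r a) s 1 (set_reg s r (memory s (regs s a)))
| exec_write s a r : exec (Write a r) s 1 (set_mem s (regs s a) (regs s r))
| exec_seq p q s1 s2 s3 t u :
    exec p s1 t s2 -> exec q s2 u s3 -> exec (Seq p q) s1 (t + u) s3
| exec_if_true r p q s s' t :
    regs s r != 0 -> exec p s t s' -> exec (If r p q) s t.+1 s'
| exec_if_false r p q s s' t :
    regs s r = 0 -> exec q s t s' -> exec (If r p q) s t.+1 s'
| exec_while_stop r p s : regs s r = 0 -> exec (While r p) s 1 s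
| exec_while_loop r p s1 s2 s3 t u :
    regs s1 r != 0 -> exec p s1 t s2 -> exec (While r p) s2 u s3 ->
    exec (While r p) s1 (t + u).+1 s3.

(* Registers 0, 1, 2 hold n, k and eta; memory holds the row-major adjacency  *)
(* matrix from address 0. Everything else is initially 0.                     *)
Definition input_state (I : instance) : state :=
  State
    (fun r => match r with
              | 0 => nverts I | 1 => budget I | 2 => imbalance I | _ => 0 end)
    (fun a => nat_of_bool
       [exists i : 'I_(nverts I), exists j : 'I_(nverts I),
          (a == i * nverts I + j) && adj (igraph I) i j]).

Definition output_state (s : state) (I : instance) : Prop :=
  [/\ regs s 0 = nverts I, regs s 1 = budget I, regs s 2 = imbalance I &
      forall i j : 'I_(nverts I),
        memory s (i * nverts I + j) = nat_of_bool (adj (igraph I) i j)].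

(* The bound on [isize (f I)] charges for the length of the output: memory    *)
(* cells that are still 0 could otherwise be output without being written.    *)
Definition polytime_computable (f : instance -> instance) : Prop :=
  exists (p : cmd) (c d : nat), forall I : instance,
    exists (t : nat) (s : state),
      [/\ exec p (input_state I) t s,
          output_state s (f I),
          t <= c * isize I ^ d + c &
          isize (f I) <= c * isize I ^ d + c].

(* Main.v *)
Require Import Defs.
From mathcomp Require Import all_boot all_order.
From mathcomp Require Import zify.

(** Vertices with equal closed neighbourhoods are twins. A solution with at most
    k edits touches at most 2k vertices, so a twin class with more than 2k members
    contains an untouched vertex, and the closed neighbourhood of the class is
    then a cluster of every solution. The vertices outside these forced clusters
    form clusters of size at most 4k. Hence truncating every twin class to 4k+1
    vertices keeps the forced clusters at least as large as all others; if other
    vertices exist, only the largest forced cluster matters for balance, and eta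
    is decreased by the amount by which it shrinks; otherwise all cluster sizes are
    known and balance is checked directly. Isolated cliques of equal size are
    interchangeable and at most 2k of them are touched, so 2k+1 copies per size
    suffice; there are O(k) sizes, which gives O(k^3) vertices. In a yes-instance
    there are at most 4k further twin classes, of O(k) vertices each.

    All quantities involved are expressions built from addition, truncated
    subtraction, case distinction, memory access and sums over the vertices. Such
    expressions are compiled to the machine with a polynomial running time, the
    degree being the nesting depth of the sums. *)

Set Implicit Arguments.
Unset Strict Implicit.
Unset Printing Implicit Defensive.

(** * Finite sets *)

Lemma leq_card_rel (T1 T2 : finType) (R : T1 -> T2 -> bool)
    (A : {set T1}) (B : {set T2}) :
  {in A, forall x, exists2 y, y \in B & R x y} ->
  {in A &, forall x x', forall y, R x y -> R x' y -> x = x'} ->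
  #|A| <= #|B|.
Proof.
move=> AB R_inj; pose f x := [pick y in B | R x y].
have fP x : x \in A -> exists y, [/\ f x = Some y, y \in B & R x y].
  move=> /AB[y yB Rxy]; rewrite /f; case: pickP => [z /andP[zB Rxz]|/(_ y)].
    by exists z.
  by rewrite yB Rxy.
have f_inj : {in A &, injective f}.
  move=> x x' xA x'A; have [y [-> _ Rxy]] := fP x xA; have [y' [-> _ Rxy']] := fP x' x'A.
  by case=> eyy'; apply: R_inj Rxy _ => //; rewrite eyy'.
rewrite -(card_in_imset f_inj) -(card_imset B (@Some_inj _)).
apply/subset_leq_card/subsetP => _ /imsetP[x /fP[y [-> yB _]] ->].
exact: imset_f.
Qed.

Lemma leq_card_bigcup (I T : finType) (A : {set I}) (F : I -> {set T}) m :
  {in A, forall i, #|F i| <= m} -> #|\bigcup_(i in A) F i| <= #|A| * m.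
Proof.
move=> Fm; rewrite -sum_nat_const.
apply: leq_trans (_ : \sum_(i in A) #|F i| <= _); last exact: leq_sum.
elim/big_rec2: _ => [|i B c _ cB]; first by rewrite cards0.
by apply: leq_trans (leq_card_setU _ _) _; rewrite leq_add2l.
Qed.

Lemma eq_card_bij (T : finType) (A B : {set T}) : #|A| = #|B| ->
  exists2 f : T -> T, {in A &, injective f} & f @: A = B.
Proof.
move=> eqAB; pose f x := nth x (enum B) (index x (enum A)).
have ltB x : x \in A -> index x (enum A) < size (enum B).
  by move=> xA; rewrite -cardE -eqAB cardE index_mem mem_enum.
have f_inj : {in A &, injective f}.
  move=> x y xA yA /eqP; rewrite /f (set_nth_default y) ?ltB //.
  rewrite nth_uniq ?ltB ?enum_uniq // => /eqP.
  by apply: (index_inj x); rewrite mem_enum.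
exists f => //; apply/eqP; rewrite eqEcard (card_in_imset f_inj) eqAB leqnn andbT.
apply/subsetP => _ /imsetP[x xA ->].
by rewrite -mem_enum mem_nth // ltB.
Qed.

Lemma ltn_bigmax (I : finType) (P : pred I) (F : I -> nat) m :
  (m < \max_(i | P i) F i) = [exists (i | P i), m < F i].
Proof.
rewrite ltnNge; apply/negP/exists_inP => [maxF|[i Pi mF]]; last first.
  by move/bigmax_leqP/(_ i Pi); rewrite leqNgt mF.
apply/exists_inP; apply: contra_notT maxF => /exists_inPn noF.
by apply/bigmax_leqP => i Pi; rewrite leqNgt noF.
Qed.

Lemma card_ord_ltn n m : #|[set i : 'I_n | i < m]| = minn n m.
Proof.
rewrite -sum1dep_card; have [le_mn|/ltnW le_nm] := leqP m n.
  by rewrite -(big_ord_widen n (fun=> 1) le_mn) sum1_card card_ord.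
rewrite (eq_bigl xpredT) => [|i]; last exact: leq_trans (ltn_ord i) le_nm.
by rewrite sum1_card card_ord.
Qed.

(** * Solutions as vertex labellings *)

Section Labellings.
Variables (V : finType) (a : rel V).
Implicit Types (S : {set V}) (l : V -> nat) (k eta : nat).

(* Ordered pairs, hence counted twice: see the factor 2 in [solution]. *)
Definition mismatches S l : {set V * V} :=
  [set p | [&& p.1 \in S, p.2 \in S & (l p.1 == l p.2) != a p.1 p.2]].

Definition touched S l : {set V} := [set p.1 | p in mismatches S l].

Definition cluster S l x : {set V} := [set z in S | l z == l x].

Definition even_clusters S eta l : Prop :=
  {in S &, forall x y, #|cluster S l x| <= #|cluster S l y| + eta}.

Definition solution S k eta l : Prop :=
  #|mismatches S l| <= k.*2 /\ even_clusters S eta l.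

Definition editable S k eta : Prop := exists l, solution S k eta l.

Lemma card_touched S l : #|touched S l| <= #|mismatches S l|.
Proof. exact: leq_imset_card. Qed.

Lemma mismatchesS S S' l : S \subset S' -> mismatches S l \subset mismatches S' l.
Proof.
move=> /subsetP sS; apply/subsetP => p; rewrite !inE.
by case/and3P=> /sS -> /sS -> ->.
Qed.

Lemma card_mismatchesS S S' l :
  S \subset S' -> #|mismatches S l| <= #|mismatches S' l|.
Proof. by move=> sS; apply/subset_leq_card/mismatchesS. Qed.

Lemma untouched_label S l x y :
  x \in S -> y \in S -> x \notin touched S l -> (l x == l y) = a x y.
Proof.
move=> xS yS; apply: contraNeq => nxy.
by apply/imsetP; exists (x, y); rewrite // inE /= xS yS.
Qed.

Lemma cluster_untouched S l u x : u \in S -> u \notin touched S l -> x \in S ->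
  a u x -> cluster S l x = [set z in S | a u z].
Proof.
move=> uS uT xS; rewrite -(untouched_label uS xS uT) => /eqP ux.
apply/setP => z; rewrite !inE; case zS : (z \in S) => //=.
by rewrite -ux eq_sym (untouched_label uS zS uT).
Qed.

Lemma even_clusters_card S l : even_clusters S #|V| l.
Proof. by move=> x y _ _; apply: leq_trans (leq_addl _ _); apply: max_card. Qed.

Lemma eq_in_cluster S l l' x : x \in S -> {in S, l' =1 l} ->
  cluster S l' x = cluster S l x.
Proof.
move=> xS ll; apply/setP => z; rewrite !inE.
by case zS: (z \in S) => //=; rewrite !ll.
Qed.

End Labellings.

Lemma even_clusters_transfer (V : finType) (S S' : {set V}) (l l' : V -> nat)
    (m eta : nat) :
  {in S, forall x, exists2 x', x' \in S' & #|cluster S l x| + m <= #|cluster S' l' x'|} ->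
  {in S, forall x, exists2 x', x' \in S' & #|cluster S' l' x'| <= #|cluster S l x|} ->
  even_clusters S' eta l' ->
  {in S &, forall x y, #|cluster S l x| + m <= #|cluster S l y| + eta}.
Proof.
move=> up lo ev x y /up[x' x'S le_x] /lo[y' y'S le_y].
apply: leq_trans le_x (leq_trans (ev x' y' x'S y'S) _).
by rewrite leq_add2r.
Qed.

Section Isomorphism.
Variables (V1 V2 : finType) (a1 : rel V1) (a2 : rel V2).
Variables (S : {set V1}) (phi : V1 -> V2).
Hypothesis phi_inj : {in S &, injective phi}.
Hypothesis phi_morph : {in S &, forall x y, a2 (phi x) (phi y) = a1 x y}.

Lemma solution_imset k eta l1 l2 : {in S, forall x, l2 (phi x) = l1 x} ->
  solution a1 S k eta l1 <-> solution a2 (phi @: S) k eta l2.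
Proof.
move=> ll.
have mE : #|mismatches a2 (phi @: S) l2| = #|mismatches a1 S l1|.
  rewrite -(@card_in_imset _ _ (fun p => (phi p.1, phi p.2))); last first.
    move=> [x1 x2] [y1 y2]; rewrite !inE /= => /and3P[x1S x2S _] /and3P[y1S y2S _].
    by case=> /phi_inj -> // /phi_inj -> //.
  apply: eq_card => -[y1 y2]; apply/idP/imsetP.
    rewrite inE /= => /and3P[/imsetP[x1 x1S ->] /imsetP[x2 x2S ->]].
    by rewrite !ll // phi_morph // => x12; exists (x1, x2); rewrite // inE /= x1S x2S.
  case=> -[x1 x2]; rewrite inE /= => /and3P[x1S x2S x12] [-> ->].
  by rewrite inE /= !imset_f // !ll // phi_morph.
have cE x : x \in S -> #|cluster (phi @: S) l2 (phi x)| = #|cluster S l1 x|.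
  move=> xS; rewrite -(@card_in_imset _ _ phi); last first.
    by move=> y z; rewrite !inE => /andP[yS _] /andP[zS _]; apply: phi_inj.
  apply: eq_card => y; apply/idP/imsetP.
    rewrite inE => /andP[/imsetP[z zS ->]].
    by rewrite !ll // => zx; exists z; rewrite // inE zS.
  by case=> z; rewrite inE => /andP[zS zx] ->; rewrite inE imset_f // !ll.
rewrite /solution mE; split=> -[-> ev]; split=> //.
  by move=> _ _ /imsetP[x xS ->] /imsetP[y yS ->]; rewrite !cE //; apply: ev.
by move=> x y xS yS; rewrite -!cE //; apply: ev; apply: imset_f.
Qed.

Lemma editable_imset k eta : editable a1 S k eta <-> editable a2 (phi @: S) k eta.
Proof.
split=> [[l sol]|[l sol]]; last first.
  by exists (l \o phi); apply: (proj2 (solution_imset _ _ _)) sol.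
exists (fun y => \sum_(x in S | phi x == y) l x).
apply: (proj1 (solution_imset _ _ _)) sol => x xS.
rewrite (big_pred1 x) // => y /=; apply/andP/eqP => [[yS /eqP]|-> //].
exact: phi_inj.
Qed.

End Isomorphism.

(** * Graphs *)

Lemma pair_set_inj (V : finType) (x y x' y' : V) : x != y ->
  [set x; y] = [set x'; y'] -> (x', y') = (x, y) \/ (x', y') = (y, x).
Proof.
move=> nxy eq_set; have := set21 x y; have := set22 x y; rewrite eq_set !inE.
case/orP=> /eqP y_; case/orP=> /eqP x_; rewrite x_ y_ ?eqxx // in nxy *.
  by right.
by left.
Qed.

Definition edges_of (V : finType) (r : rel V) : {set {set V}} :=
  [set e in pairs V | [exists x, exists y, (e == [set x; y]) && r x y]].

Lemma edges_of_pairs (V : finType) (r : rel V) : edges_of r \subset pairs V.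
Proof. by apply/subsetP => e; rewrite inE => /andP[]. Qed.

Lemma mem_edges_of (V : finType) (r : rel V) x y : symmetric r ->
  ([set x; y] \in edges_of r) = (x != y) && r x y.
Proof.
move=> r_sym; rewrite !inE cards2 eqSS eqb1; have [//|nxy] := eqVneq x y.
apply/existsP/idP => [[u /existsP[v /andP[/eqP/(pair_set_inj nxy)]]]|/= rxy].
  by case=> -[-> ->] //; rewrite r_sym.
by exists x; apply/existsP; exists y; rewrite eqxx.
Qed.

Lemma card_ordered_pairs (V : finType) (F : {set {set V}}) : F \subset pairs V ->
  #|[set p : V * V | (p.1 != p.2) && ([set p.1; p.2] \in F)]| = #|F|.*2.
Proof.
move=> FP; rewrite -sum1_card.
rewrite (partition_big (fun p => [set p.1; p.2]) (mem F)) /= => [|p]; last first.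
  by rewrite inE => /andP[].
rewrite -muln2 -sum_nat_const; apply: eq_bigr => e eF.
have /cards2P[x [y [nxy def_e]]] : #|e| == 2 by have := subsetP FP _ eF; rewrite inE.
rewrite sum1_card; transitivity #|[set (x, y); (y, x)]|; last first.
  by rewrite cards2 xpair_eqE (negbTE nxy).
apply: eq_card => -[u v]; rewrite unfold_in /= !inE /=; apply/andP/orP.
  by rewrite def_e => -[_ /eqP/esym/(pair_set_inj nxy)[] ->]; [left | right].
case=> /eqP[-> ->]; first by rewrite nxy -def_e eF.
by rewrite eq_sym nxy setUC -def_e eF.
Qed.

Section Graph.
Variables (V : finType) (G : graph V).

Definition nbr : rel V := fun x y => (x == y) || adj G x y.

Lemma adj_sym : symmetric (adj G).
Proof. by move=> x y; rewrite /adj setUC. Qed.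

Lemma adj_irr x : adj G x x = false.
Proof. by apply/negP => /(subsetP (edges_pairs G)); rewrite inE setUid cards1. Qed.

Lemma nbr_refl : reflexive nbr.
Proof. by move=> x; rewrite /nbr eqxx. Qed.

Lemma nbr_sym : symmetric nbr.
Proof. by move=> x y; rewrite /nbr eq_sym adj_sym. Qed.

Lemma adj_nbr x y : adj G x y = (x != y) && nbr x y.
Proof. by rewrite /nbr; case: eqP => // ->; rewrite adj_irr. Qed.

Lemma adj_edit (F : {set {set V}}) (FP : F \subset pairs V) x y :
  adj (edit G FP) x y = (adj G x y != ([set x; y] \in F)).
Proof.
rewrite /adj /edit /= /symdiff !inE.
by case: (_ \in edges G); case: (_ \in F).
Qed.

End Graph.

Section ClusterLabels.
Variables (V : finType) (G : graph V).
Implicit Type l : V -> nat.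

Definition cluster_labels l := forall x y, (l x == l y) = nbr G x y.

Lemma connect_labels l : cluster_labels l ->
  forall x y, connect (adj G) x y = (l x == l y).
Proof.
move=> lG x y; apply/idP/idP; last by rewrite lG => /orP[/eqP -> //|/connect1].
case/connectP=> p; elim: p x => [|z p IHp] x /=; first by move=> _ ->.
by case/andP=> xz /IHp xp /xp /eqP <-; rewrite lG /nbr xz orbT.
Qed.

Lemma component_labels l : cluster_labels l ->
  component_of G =1 cluster setT l.
Proof. by move=> lG x; apply/setP => z; rewrite !inE (connect_labels lG) eq_sym. Qed.

Lemma cluster_graphP : cluster_graph G <-> exists l, cluster_labels l.
Proof.
split=> [cG|[l lG] _ /imsetP[x _ ->] y z]; last first.
  rewrite (component_labels lG) !inE => /eqP yx /eqP zx.
  by rewrite adj_nbr -lG yx zx eqxx andbT.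
have adj_conn_sym : connect_sym (adj G) by apply: sym_connect_sym; apply: adj_sym.
exists (fun x => nat_of_ord (enum_rank (fingraph.root (adj G) x))) => x y.
rewrite (inj_eq val_inj) (inj_eq enum_rank_inj) root_connect //.
apply/idP/orP => [xy|[/eqP -> //|/connect1 //]].
have [->|nxy] := eqVneq x y; [by left | right].
by apply: (cG (component_of G x)); rewrite ?imset_f // inE.
Qed.

Lemma balanced_labels eta l : cluster_labels l ->
  balanced eta G <-> even_clusters setT eta l.
Proof.
move=> lG; split=> [bal x y _ _|ev _ _ /imsetP[x _ ->] /imsetP[y _ ->]].
  have := bal (component_of G x) (component_of G y) (imset_f _ isT) (imset_f _ isT).
  by rewrite !(component_labels lG); lia.
rewrite !(component_labels lG).
by have := ev x y (in_setT x) (in_setT y); have := ev y x (in_setT y) (in_setT x); lia.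
Qed.

End ClusterLabels.

Lemma card_mismatches_edit (V : finType) (G : graph V) (F : {set {set V}})
    (FP : F \subset pairs V) l :
  cluster_labels (edit G FP) l -> #|mismatches (nbr G) setT l| = #|F|.*2.
Proof.
move=> lE; rewrite -(card_ordered_pairs FP); apply: eq_card => -[x y].
rewrite !inE /= lE /nbr; case: (eqVneq x y) => //= _; rewrite adj_edit.
by case: (adj G x y); case: (_ \in F).
Qed.

Lemma yes_instanceE I :
  yes_instance I <->
  editable (nbr (igraph I)) setT (budget I) (imbalance I).
Proof.
case: I => n G k eta; rewrite /yes_instance /=.
split=> [[F [FP [Fk /cluster_graphP[l lE] /(balanced_labels _ lE) ev]]]|[l [lk ev]]].
  by exists l; split; rewrite ?(card_mismatches_edit lE) ?leq_double.
pose mismatch x y := (l x == l y) != nbr G x y.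
have mismatch_sym : symmetric mismatch.
  by move=> x y; rewrite /mismatch (eq_sym (l x)) nbr_sym.
pose FP := edges_of_pairs mismatch.
have lE : cluster_labels (edit G FP) l.
  move=> x y; rewrite /nbr adj_edit mem_edges_of // /mismatch /nbr.
  by case: (eqVneq x y) => [->|_] /=; [rewrite eqxx | case: (_ == _); case: (adj G x y)].
exists (edges_of mismatch), FP; split.
- by rewrite -leq_double -(card_mismatches_edit lE).
- by apply/cluster_graphP; exists l.
- exact/(balanced_labels _ lE).
Qed.

Definition graph_of (V : finType) (r : rel V) : graph V := Graph (edges_of_pairs r).

Lemma adj_graph_of (V : finType) (r : rel V) x y : symmetric r ->
  adj (graph_of r) x y = (x != y) && r x y.
Proof. exact: mem_edges_of. Qed.

Section InducedSubgraph.
Variables (V : finType) (G : graph V) (A : {set V}).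

Definition induced : graph 'I_#|A| := graph_of (relpre enum_val (adj G)).

Lemma adj_induced x y : adj induced x y = adj G (enum_val x) (enum_val y).
Proof.
rewrite adj_graph_of => [|{}x {}y]; last exact: adj_sym.
by rewrite /= adj_nbr (inj_eq enum_val_inj) andbA andbb.
Qed.

Lemma editable_induced k eta :
  editable (nbr induced) setT k eta <-> editable (nbr G) A k eta.
Proof.
have enum_im : [set enum_val x | x in [set: 'I_#|A|]] = A.
  apply/eqP; rewrite eqEcard card_imset; last exact: enum_val_inj.
  rewrite cardsT card_ord leqnn andbT.
  by apply/subsetP => _ /imsetP[x _ ->]; apply: enum_valP.
rewrite -[X in editable (nbr G) X]enum_im.
apply: editable_imset => [x y _ _ /enum_val_inj //|x y _ _].
by rewrite /nbr (inj_eq enum_val_inj) adj_induced.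
Qed.

End InducedSubgraph.

(** * Twin classes *)

Section Twins.
Variables (V : finType) (a : rel V).
Implicit Types (S U W K : {set V}) (l : V -> nat) (i j u v x y z : V).

Definition twin : rel V := fun i j => [forall w, a i w == a j w].
Definition class i : {set V} := [set j | twin i j].
Definition isolated i : bool := [forall j, a i j ==> twin i j].
Definition twin_free U : Prop := {in U &, forall u u', twin u u' -> u = u'}.

Lemma twinP i j : reflect (a i =1 a j) (twin i j).
Proof. by apply: (iffP forallP) => tw w; apply/eqP. Qed.

Lemma twin_refl : reflexive twin. Proof. by move=> i; apply/twinP. Qed.

Lemma twin_sym : symmetric twin.
Proof. by move=> i j; apply/twinP/twinP => tw w; rewrite tw. Qed.

Lemma twin_trans : transitive twin.
Proof. by move=> j i u /twinP ij /twinP ju; apply/twinP => w; rewrite ij. Qed.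

Lemma twin_eql i j : twin i j -> twin i =1 twin j.
Proof.
move=> ij u; apply/idP/idP; last exact: twin_trans.
by apply: twin_trans; rewrite twin_sym.
Qed.

Lemma class_eq i j : twin i j -> class i = class j.
Proof. by move=> ij; apply/setP => u; rewrite !inE (twin_eql ij). Qed.

Lemma mem_class i : i \in class i. Proof. by rewrite inE twin_refl. Qed.

Lemma class_gt0 i : 0 < #|class i|.
Proof. by apply/card_gt0P; exists i; apply: mem_class. Qed.

Lemma isolated_twin i j : twin i j -> isolated i = isolated j.
Proof.
move=> ij; apply: eq_forallb => u.
by rewrite (elimT (twinP i j) ij) (twin_eql ij).
Qed.

Hypotheses (a_refl : reflexive a) (a_sym : symmetric a).

Lemma twin_nbr i j : twin i j -> a i j.
Proof. by move/twinP/(_ j) => ->. Qed.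

Lemma twin_nbrr i j w : twin i j -> a w i = a w j.
Proof. by move/twinP => ij; rewrite a_sym ij a_sym. Qed.

Lemma nbr_isolated i j : isolated i -> a i j = twin i j.
Proof. by move/forallP/(_ j)/implyP => ij; apply/idP/idP => // /twin_nbr. Qed.

Lemma nbr_isolated_class u x y : isolated u -> twin u x -> a x y = twin u y.
Proof. by move=> iu /twinP <-; rewrite nbr_isolated. Qed.

Lemma cluster_isolated S l u x : isolated u -> x \in S -> twin u x ->
  x \notin touched a S l -> cluster S l x = class u :&: S.
Proof.
move=> iu xS ux xT; rewrite (cluster_untouched xS xT xS) //; apply/setP => z.
by rewrite !inE (nbr_isolated_class _ iu ux) andbC.
Qed.

Lemma untouched_class S l U : twin_free U ->
  #|touched a S l| < #|U| ->
  exists2 u, u \in U & [disjoint class u & touched a S l].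
Proof.
move=> U_inj; rewrite ltnNge => card_lt; apply/exists_inP.
apply: contra_notT (negP card_lt) => /exists_inPn all_touched.
apply: (@leq_card_rel _ _ twin) => [u /all_touched|u u' uU u'U x ux u'x].
  by rewrite disjoints_subset => /subsetPn[x]; rewrite !inE negbK; exists x.
by apply: U_inj => //; apply: twin_trans ux _; rewrite twin_sym.
Qed.

(** * Truncating the twin classes *)

Section Truncation.
Variable k : nat.

Definition width : nat := (4 * k).+1.
Definition capped_size i : nat := minn #|class i| width.
Definition large : {set V} := [set i | k.*2 < #|class i|].
Definition unforced : {set V} := [set i | [forall j in large, ~~ a i j]].
Definition deg S i : nat := #|[set j in S | a i j]|.
Definition maxdeg S : nat := \max_(i in large) deg S i.
Definition shrink W : nat := maxdeg setT - maxdeg W.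

Definition faithful S : Prop := forall i, capped_size i <= #|class i :&: S|.
Definition truncation W : Prop := forall i, #|class i :&: W| = capped_size i.

Lemma capped_size_twin i j : twin i j -> capped_size i = capped_size j.
Proof. by rewrite /capped_size => /class_eq ->. Qed.

Lemma faithfulT : faithful setT.
Proof. by move=> i; rewrite setIT geq_minl. Qed.

Lemma unforcedPn x : x \notin unforced -> exists2 i, i \in large & a i x.
Proof. by rewrite inE => /forall_inPn[i iL]; rewrite negbK a_sym; exists i. Qed.

Lemma unforced_large x i : x \in unforced -> i \in large -> a i x = false.
Proof. by rewrite inE a_sym => /forall_inP far /far /negbTE. Qed.

Lemma deg_le_maxdeg S i : i \in large -> deg S i <= maxdeg S.
Proof. by move=> iL; apply: (leq_bigmax_cond (F := deg S)). Qed.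

Lemma maxdegP S i : i \in large -> exists2 j, j \in large & maxdeg S = deg S j.
Proof.
move=> iL; have L0 : 0 < #|large| by apply/card_gt0P; exists i.
by have [j jL ej] := eq_bigmax_cond (deg S) L0; exists j.
Qed.

Lemma maxdeg_le_card S : maxdeg S <= #|V|.
Proof. by apply/bigmax_leqP => i _; apply: max_card. Qed.

Section FewMismatches.
Variables (S : {set V}) (l : V -> nat).
Hypotheses (fS : faithful S) (few : #|mismatches a S l| <= k.*2).

Let card_touched_few : #|touched a S l| <= k.*2.
Proof. exact: leq_trans (card_touched a S l) few. Qed.

Lemma faithful_rep i : exists2 j, j \in S & twin i j.
Proof.
have : 0 < #|class i :&: S| by apply: leq_trans (fS i); rewrite leq_min class_gt0.
by case/card_gt0P => j; rewrite !inE => /andP[]; exists j.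
Qed.

Lemma faithful_twin u v : {in S, a u =1 a v} -> twin u v.
Proof.
move=> uv; apply/twinP => w; have [w' w'S ww'] := faithful_rep w.
by rewrite !(twin_nbrr _ ww') uv.
Qed.

Lemma large_untouched i : i \in large ->
  exists u, [/\ u \in S, u \notin touched a S l & twin i u].
Proof.
rewrite inE => iL; have : ~~ (class i :&: S \subset touched a S l).
  apply/negP => /subset_leq_card; rewrite leqNgt => /negP; apply.
  apply: leq_ltn_trans card_touched_few _; apply: leq_trans (fS i).
  by rewrite leq_min iL /= /width; lia.
by case/subsetPn => u; rewrite !inE => /andP[iu uS] uT; exists u.
Qed.

Lemma cluster_large i x : i \in large -> x \in S -> a i x ->
  cluster S l x = [set z in S | a i z].
Proof.
move=> /large_untouched[u [uS uT /twinP iu]] xS; rewrite iu => ux.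
rewrite (cluster_untouched uS uT xS ux); apply/setP => z.
by rewrite !inE iu.
Qed.

Lemma large_cluster i : i \in large -> exists2 x, x \in S & #|cluster S l x| = deg S i.
Proof.
move=> iL; have [u [uS _ iu]] := large_untouched iL.
by exists u => //; rewrite (cluster_large iL uS (twin_nbr iu)).
Qed.

Lemma maxdeg_cluster i : i \in large -> exists2 x, x \in S & #|cluster S l x| = maxdeg S.
Proof. by move=> /(maxdegP S)[j jL ->]; apply: large_cluster. Qed.

Lemma cluster_unforced x : x \in S -> x \in unforced -> cluster S l x \subset unforced.
Proof.
move=> xS xR; apply/subsetP => z; rewrite inE => /andP[zS /eqP zx].
apply: contraT => /unforcedPn[i iL iz].
have /setP/(_ x) := cluster_large iL zS iz.
by rewrite !inE xS zx eqxx (unforced_large xR).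
Qed.

(* The untouched vertices of such a cluster are mutual twins, hence at most 2k. *)
Lemma card_cluster_unforced x : x \in S -> x \in unforced -> #|cluster S l x| <= 4 * k.
Proof.
move=> xS xR; rewrite -(cardsID (touched a S l)).
have -> : 4 * k = k.*2 + k.*2 by lia.
apply: leq_add; first exact: leq_trans (subset_leq_card (subsetIr _ _)) _.
have [->|[u]] := set_0Vmem (cluster S l x :\: touched a S l); first by rewrite cards0.
rewrite inE => /andP[uT uC].
have uR := subsetP (cluster_unforced xS xR) _ uC.
move: uC; rewrite inE => /andP[uS /eqP ux].
have uL : u \notin large by apply/negP => /(unforced_large uR); rewrite a_refl.
apply: leq_trans (_ : #|class u| <= _); last by rewrite inE -leqNgt in uL.
apply/subset_leq_card/subsetP => v; rewrite !inE => /and3P[vT vS /eqP vx].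
apply: faithful_twin => w wS.
by rewrite -(untouched_label uS wS uT) -(untouched_label vS wS vT) ux vx.
Qed.

End FewMismatches.

Section Truncated.
Variable W : {set V}.
Hypothesis truncW : truncation W.

Lemma truncation_faithful : faithful W.
Proof. by move=> i; rewrite truncW. Qed.

Lemma width_lt_class i : i \notin W -> width < #|class i|.
Proof.
move=> iW; have : #|class i :&: W| < #|class i|.
  apply/proper_card/properP; split; first exact: subsetIl.
  by exists i; rewrite ?inE ?twin_refl // (negbTE iW) andbF.
by rewrite truncW /capped_size; lia.
Qed.

Lemma notin_truncation_large i : i \notin W -> i \in large.
Proof. by move/width_lt_class; rewrite inE /width; lia. Qed.

Lemma unforced_sub_truncation : unforced \subset W.
Proof.
apply/subsetP => x xR; apply: contraT => /notin_truncation_large/(unforced_large xR).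
by rewrite a_refl.
Qed.

Lemma deg_truncation_le i : deg W i <= deg setT i.
Proof. by apply/subset_leq_card/subsetP => j; rewrite !inE => /andP[_ ->]. Qed.

Lemma maxdeg_truncation_le : maxdeg W <= maxdeg setT.
Proof.
apply/bigmax_leqP => i iL.
exact: leq_trans (deg_truncation_le i) (deg_le_maxdeg _ iL).
Qed.

Lemma deg_truncation i : deg W i = deg setT i \/ width <= deg W i.
Proof.
have [sub|] := boolP [forall j, a i j ==> (j \in W)].
  left; apply: eq_card => j; rewrite !inE.
  by have := forallP sub j; case: (a i j); rewrite ?andbF //= => ->.
case/forallPn => j; rewrite negb_imply => /andP[aij /width_lt_class jW]; right.
rewrite -[width](minn_idPr (ltnW jW)) -/(capped_size j) -truncW.
apply/subset_leq_card/subsetP => u.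
by rewrite !inE => /andP[ju ->]; rewrite -(twin_nbrr _ ju).
Qed.

Lemma shrink_gt0 : 0 < shrink W ->
  width <= maxdeg W /\ exists i, i \in large.
Proof.
rewrite subn_gt0 ltn_bigmax => /exists_inP[i iL lt_i].
split; last by exists i.
by have := deg_le_maxdeg W iL; case: (deg_truncation i) => [e|]; lia.
Qed.

(* Vertices outside the truncation join the label of an untouched twin. *)
Lemma extend_truncation l : #|mismatches a W l| <= k.*2 ->
  exists2 l', #|mismatches a setT l'| <= k.*2 & {in W, l' =1 l}.
Proof.
move=> few; have /fin_all_exists[pi piP] v : exists u,
    [/\ u \in W, twin v u & if v \in W then u = v else u \notin touched a W l].
  case: (boolP (v \in W)) => [vW|/notin_truncation_large vL].
    by exists v; rewrite twin_refl.
  by have [u []] := large_untouched truncation_faithful few vL; exists u.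
exists (l \o pi) => [|x xW /=]; last by have [_ _] := piP x; rewrite xW => ->.
apply: leq_trans few; apply/subset_leq_card/subsetP => -[x y].
have [pixW /twinP x_pi xT] := piP x; have [piyW y_pi yT] := piP y.
rewrite inE /= !in_setT /= x_pi (twin_nbrr _ y_pi).
case: ifP xT => [xW ->|_ xT]; last by rewrite (untouched_label pixW piyW xT) eqxx.
case: ifP yT => [yW -> xy|_ yT]; first by rewrite inE /= xW yW.
by rewrite (eq_sym (l x)) a_sym (untouched_label piyW _ yT) ?eqxx.
Qed.

Section Balance.
Variable l : V -> nat.
Hypothesis few : #|mismatches a setT l| <= k.*2.

Lemma few_truncation : #|mismatches a W l| <= k.*2.
Proof. exact: leq_trans (card_mismatchesS _ _ (subsetT W)) few. Qed.

Let fW := truncation_faithful.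
Let fewW := few_truncation.

Lemma cluster_unforced_truncation x : x \in unforced -> cluster W l x = cluster setT l x.
Proof.
move=> xR; apply/setP => z; rewrite !inE /=.
case zx: (l z == l x); rewrite ?andbF // andbT.
apply: (subsetP unforced_sub_truncation).
by apply: (subsetP (cluster_unforced faithfulT few (in_setT x) xR)); rewrite !inE.
Qed.

Lemma cluster_truncation_upper x : x \in W ->
  exists2 y, y \in [set: V] & #|cluster W l x| + shrink W <= #|cluster setT l y|.
Proof.
move=> xW; have maxW := maxdeg_truncation_le.
have below_max i : i \in large -> #|cluster W l x| <= maxdeg W ->
    exists2 y, y \in [set: V] & #|cluster W l x| + shrink W <= #|cluster setT l y|.
  move=> iL le_x; have [y yT ey] := maxdeg_cluster faithfulT few iL.
  by exists y; rewrite // ey /shrink; lia.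
have [xR|/unforcedPn[i iL ix]] := boolP (x \in unforced); last first.
  by apply: (below_max i) => //; rewrite (cluster_large fW fewW iL xW ix) deg_le_maxdeg.
have [->|/shrink_gt0[le_max [i iL]]] := posnP (shrink W).
  by exists x; rewrite // addn0 cluster_unforced_truncation.
apply: (below_max i) => //; apply: leq_trans le_max.
exact: leqW (card_cluster_unforced fW fewW xW xR).
Qed.

Lemma cluster_upper_truncation x :
  exists2 y, y \in W & #|cluster setT l x| <= #|cluster W l y| + shrink W.
Proof.
have [xR|/unforcedPn[i iL ix]] := boolP (x \in unforced).
  exists x; first exact: (subsetP unforced_sub_truncation).
  by rewrite cluster_unforced_truncation // leq_addr.
have [y yW ey] := maxdeg_cluster fW fewW iL.
exists y => //; rewrite ey (cluster_large faithfulT few iL (in_setT x) ix).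
by have := deg_le_maxdeg setT iL; rewrite /shrink /deg; lia.
Qed.

Lemma cluster_lower_truncation x :
  exists2 y, y \in W & #|cluster W l y| <= #|cluster setT l x|.
Proof.
have [xR|/unforcedPn[i iL ix]] := boolP (x \in unforced).
  exists x; first exact: (subsetP unforced_sub_truncation).
  by rewrite cluster_unforced_truncation.
have [y yW ey] := large_cluster fW fewW iL.
exists y => //; rewrite ey (cluster_large faithfulT few iL (in_setT x) ix).
exact: deg_truncation_le.
Qed.

Lemma cluster_truncation_lower r x : r \in unforced -> x \in W ->
  exists2 y, y \in [set: V] & #|cluster setT l y| <= #|cluster W l x|.
Proof.
move=> rR xW; have [xR|/unforcedPn[i iL ix]] := boolP (x \in unforced).
  by exists x; rewrite // cluster_unforced_truncation.
rewrite (cluster_large fW fewW iL xW ix) -/(deg W i).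
have [->|le_i] := deg_truncation i.
  by have [y yT ey] := large_cluster faithfulT few iL; exists y; rewrite ?ey.
exists r => //; apply: leq_trans le_i.
exact: leqW (card_cluster_unforced faithfulT few (in_setT r) rR).
Qed.

Lemma even_clusters_truncation eta : unforced != set0 ->
  even_clusters setT eta l <->
  shrink W <= eta /\ even_clusters W (eta - shrink W) l.
Proof.
case/set0Pn => r rR; have rW := subsetP unforced_sub_truncation _ rR.
split=> [ev|[le_eta ev]].
  have le_W := even_clusters_transfer cluster_truncation_upper
    (fun x => cluster_truncation_lower rR (x := x)) ev.
  split=> [|x y xW yW]; first by have := le_W r r rW rW; lia.
  by have := le_W x y xW yW; have := le_W r r rW rW; lia.
move=> x y _ _; have [x' x'W le_x] := cluster_upper_truncation x.
have [y' y'W le_y] := cluster_lower_truncation y.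
by have := ev x' y' x'W y'W; lia.
Qed.

Lemma even_clusters_large eta : unforced = set0 ->
  even_clusters setT eta l <->
  {in large &, forall i j, deg setT i <= deg setT j + eta}.
Proof.
move=> R0; have near x : exists2 i, i \in large & a i x.
  by apply: unforcedPn; rewrite R0 inE.
split=> [ev i j iL jL|ev x y _ _].
  have [x xT <-] := large_cluster faithfulT few iL.
  by have [y yT <-] := large_cluster faithfulT few jL; apply: ev.
have [i iL ix] := near x; have [j jL jy] := near y.
rewrite (cluster_large faithfulT few iL (in_setT x) ix).
by rewrite (cluster_large faithfulT few jL (in_setT y) jy); apply: ev.
Qed.

End Balance.

Lemma editable_truncation_unforced eta : unforced != set0 ->
  editable a setT k eta <-> shrink W <= eta /\ editable a W k (eta - shrink W).
Proof.
move=> R0; split=> [[l [few ev]]|[le_eta [l [few ev]]]].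
  have [le_eta evW] := proj1 (even_clusters_truncation few _ R0) ev.
  by split=> //; exists l; split=> //; apply: few_truncation.
have [l' few' ll'] := extend_truncation few.
exists l'; split=> //; apply/(even_clusters_truncation few' _ R0); split=> // x y xW yW.
by rewrite !(eq_in_cluster _ ll') //; apply: ev.
Qed.

Lemma editable_truncation_large eta : unforced = set0 ->
  editable a setT k eta <->
  {in large &, forall i j, deg setT i <= deg setT j + eta} /\ editable a W k #|V|.
Proof.
move=> R0; split=> [[l [few /(even_clusters_large few _ R0) ev]]|[ev [l [few _]]]].
  by split=> //; exists l; split; [exact: few_truncation | exact: even_clusters_card].
have [l' few' _] := extend_truncation few.
by exists l'; split=> //; apply/(even_clusters_large few' _ R0).
Qed.

End Truncated.
End Truncation.

(** * Removing isolated cliques *)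

Section DropClique.
Variables (k eta : nat) (S U : {set V}) (v : V).
Hypotheses (vS : v \in S) (v_iso : isolated v) (U_card : k.*2 < #|U|).
Hypothesis U_inj : twin_free U.
Hypothesis U_iso : {in U, forall u, isolated u}.
Hypothesis U_size : {in U, forall u, #|class u :&: S| = #|class v :&: S|}.
Hypothesis U_v : {in U, forall u, ~~ twin u v}.

Lemma twin_U_notin_v u x : u \in U -> twin u x -> ~~ twin v x.
Proof.
by move=> uU ux; apply: contra (U_v uU) => vx; rewrite twin_sym (twin_eql vx) twin_sym.
Qed.

Lemma editable_swap_clique u : u \in U ->
  editable a (S :\: class v) k eta <-> editable a (S :\: class u) k eta.
Proof.
move=> uU; have uI := U_iso uU; have [f f_inj f_im] := eq_card_bij (U_size uU).
pose phi x := if twin u x then f x else x.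
have fP x : x \in S -> twin u x -> twin v (f x) && (f x \in S).
  move=> xS ux; have : f x \in class v :&: S by rewrite -f_im imset_f // !inE ux.
  by rewrite !inE.
have inS x : x \in S :\: class v -> x \in S /\ ~~ twin v x by rewrite !inE => /andP[].
have phi_v x : x \in S :\: class v -> twin v (phi x) = twin u x.
  move=> /inS[xS /negbTE vx]; rewrite /phi; case: ifP => // ux.
  by case/andP: (fP x xS ux).
have phi_inj : {in S :\: class v &, injective phi}.
  move=> x y xD yD eq_phi; have := phi_v x xD; rewrite eq_phi phi_v // => uxy.
  move: eq_phi xD yD; rewrite /phi -uxy; case: ifP => // uy eq_f /inS[xS _] /inS[yS _].
  by apply: f_inj eq_f; rewrite !inE ?xS ?yS -?uxy uy.
have phi_morph : {in S :\: class v &, forall x y, a (phi x) (phi y) = a x y}.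
  have morph_u x y : x \in S :\: class v -> y \in S :\: class v -> twin u x ->
      a (phi x) (phi y) = a x y.
    move=> xD yD ux; rewrite (nbr_isolated_class _ uI ux) -phi_v //.
    by apply: nbr_isolated_class; rewrite ?phi_v.
  move=> x y xD yD; have [ux|ux] := boolP (twin u x); first exact: morph_u.
  have [uy|uy] := boolP (twin u y); first by rewrite a_sym morph_u // a_sym.
  by rewrite /phi (negbTE ux) (negbTE uy).
rewrite (editable_imset phi_inj phi_morph) (_ : phi @: _ = S :\: class u) //.
apply/eqP; rewrite eqEcard card_in_imset // !cardsD ![S :&: _]setIC U_size // leqnn andbT.
apply/subsetP => _ /imsetP[x xD ->]; have [xS vx] := inS x xD.
rewrite !inE /phi; case: ifP => [ux|ux]; last by rewrite ux.
have /andP[vfx ->] := fP x xS ux; rewrite andbT.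
by apply: contraL vfx => /(twin_U_notin_v uU).
Qed.

Lemma solution_drop_class l u : isolated u -> [disjoint class u & touched a S l] ->
  solution a S k eta l -> solution a (S :\: class u) k eta l.
Proof.
move=> uI /disjointFr uT [few ev]; split.
  exact: leq_trans (card_mismatchesS _ _ (subsetDl _ _)) few.
have cE x : x \in S :\: class u -> cluster (S :\: class u) l x = cluster S l x.
  rewrite !inE => /andP[ux xS]; apply/setP => z; rewrite !inE.
  case zS: (z \in S); rewrite ?andbF //= andbT andb_idl // => /eqP zx.
  apply: contra ux => uz; have zT : z \notin touched a S l by rewrite uT // inE.
  have /setP/(_ x) := cluster_isolated uI zS uz zT.
  by rewrite !inE xS zx eqxx !andbT => <-.
move=> x y xD yD; rewrite !cE //.
by apply: ev; apply: (subsetP (subsetDl S (class u))).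
Qed.

(* The class of v becomes a cluster, as large as that of an untouched u in U. *)
Lemma editable_add_class : editable a (S :\: class v) k eta -> editable a S k eta.
Proof.
set S' := S :\: class v => -[l [few ev]].
have few_touched : #|touched a S' l| < #|U|.
  exact: leq_ltn_trans (leq_trans (card_touched _ _ _) few) U_card.
have [u uU /disjointFr uT] := untouched_class U_inj few_touched.
pose l' z := if twin v z then 0 else (l z).+1.
have clv x : twin v x -> cluster S l' x = class v :&: S.
  by move=> vx; apply/setP => z; rewrite !inE /l' vx andbC; case: (twin v z).
have clnv x : ~~ twin v x -> cluster S l' x = cluster S' l x.
  move=> vx; apply/setP => z; rewrite !inE /l' (negbTE vx).
  by case: (twin v z); rewrite ?andbF.
have old_cluster x : x \in S ->
    exists2 x', x' \in S' & #|cluster S l' x| = #|cluster S' l x'|.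
  move=> xS; have [vx|vx] := boolP (twin v x); last by exists x; rewrite ?clnv // !inE vx.
  have : 0 < #|class u :&: S|.
    by rewrite U_size //; apply/card_gt0P; exists v; rewrite !inE twin_refl.
  case/card_gt0P => w; rewrite !inE => /andP[uw wS].
  have wS' : w \in S' by rewrite !inE wS (twin_U_notin_v uU uw).
  have wT : w \notin touched a S' l by rewrite uT // inE.
  exists w; rewrite // clv // -(U_size uU) (cluster_isolated (U_iso uU) wS' uw wT).
  apply: eq_card => z; rewrite !inE; have [uz|//] := boolP (twin u z).
  by rewrite (twin_U_notin_v uU uz).
exists l'; split; last first.
  by move=> x y /old_cluster[x' x'S ->] /old_cluster[y' y'S ->]; apply: ev.
apply: leq_trans few; apply/subset_leq_card/subsetP => -[x y].
rewrite ![_ \in mismatches _ _ _]inE /= !inE /l' => /and3P[-> ->]; rewrite !andbT.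
case vx: (twin v x); first by rewrite (nbr_isolated_class _ v_iso vx); case: (twin v y).
by case vy: (twin v y); rewrite //= a_sym (nbr_isolated_class _ v_iso vy) vx.
Qed.

Lemma editable_drop_class : editable a S k eta <-> editable a (S :\: class v) k eta.
Proof.
split=> [[l sol]|]; last exact: editable_add_class.
have few_touched : #|touched a S l| < #|U|.
  exact: leq_ltn_trans (leq_trans (card_touched _ _ _) sol.1) U_card.
have [u uU uT] := untouched_class U_inj few_touched.
apply/(editable_swap_clique uU); exists l.
exact: solution_drop_class (U_iso uU) uT sol.
Qed.

End DropClique.

Lemma editable_drop_cliques (k eta : nat) W K : K \subset W ->
  (forall x y, twin x y -> x \in K -> y \in W -> y \in K) ->
  (forall v, v \in W :\: K -> isolated v /\ exists U,
     [/\ U \subset K, k.*2 < #|U|, twin_free U &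
     {in U, forall u, isolated u /\ #|class u :&: W| = #|class v :&: W|}]) ->
  editable a W k eta <-> editable a K k eta.
Proof.
have [m] := ubnP #|W :\: K|; elim: m W => // m IHm W card_lt sKW K_closed surplus.
have [/eqP WK0|[v vD]] := set_0Vmem (W :\: K).
  by rewrite setD_eq0 in WK0; have -> : W = K by apply/eqP; rewrite eqEsubset WK0.
have [v_iso [U [/subsetP sUK U_card U_inj U_P]]] := surplus v vD.
move: (vD); rewrite inE => /andP[vK vW].
have notin_v x : x \in K -> ~~ twin x v.
  by move=> xK; apply: contra vK => xv; apply: K_closed xv xK vW.
have class_notin x : ~~ twin x v -> class x :&: (W :\: class v) = class x :&: W.
  move=> xv; apply/setP => z; rewrite !inE; case xz: (twin x z) => //=.
  by rewrite twin_sym -(twin_eql xz) xv.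
rewrite (editable_drop_class eta vW v_iso U_card U_inj); first last.
- by move=> u /sUK; apply: notin_v.
- by move=> u /U_P[].
- by move=> u /U_P[].
apply: IHm => [|||v' v'D].
- rewrite -ltnS; apply: leq_trans card_lt; apply/proper_card/properP; split.
    exact/setSD/subsetDl.
  by exists v; rewrite // !inE twin_refl andbF.
- apply/subsetP => x xK; rewrite !inE (subsetP sKW) // andbT twin_sym.
  exact: notin_v.
- by move=> x y xy xK /setDP[yW _]; apply: K_closed xy xK yW.
have v'v : ~~ twin v' v by move: v'D; rewrite !inE twin_sym => /and3P[].
have [|v'_iso [U' [sUK' U'_card U'_inj U'_P]]] := surplus v'.
  by apply: (subsetP (setSD _ (subsetDl _ _)) _ v'D).
split=> //; exists U'; split=> // u uU'; have [u_iso u_size] := U'_P u uU'.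
by rewrite !class_notin // notin_v // (subsetP sUK').
Qed.

End Twins.

(** * The kept vertices *)

Section Rank.
Variables (n : nat) (P : {set 'I_n}).
Implicit Types i j : 'I_n.

Definition rank (m : nat) : nat := #|[set j in P | j < m]|.

Lemma rank_enum_val (x : 'I_#|P|) : rank (enum_val x) = x.
Proof.
have sorted_P : sorted ltn (map val (enum P)).
  rewrite sorted_map; apply: sorted_filter => [j i u|]; first exact: ltn_trans.
  by rewrite -enumT -sorted_map val_enum_ord iota_ltn_sorted.
have ltx : x < size (enum P) by rewrite -cardE.
have <- : count (fun m => m < enum_val x) (map val (enum P)) = rank (enum_val x).
  by rewrite count_map /rank -sum1dep_card -big_enum_cond sum1_count.
rewrite (enum_val_nth (enum_val x)) -(nth_map _ 0) //.
by apply: Order.POrderTheory.count_lt_nth; rewrite ?size_map.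
Qed.

Lemma enum_val_rank i : i \in P -> exists2 x : 'I_#|P|, i = enum_val x & rank i = x.
Proof.
move=> iP; exists (enum_rank_in iP i); first by rewrite enum_rankK_in.
by rewrite -rank_enum_val enum_rankK_in.
Qed.

Lemma card_rank_ltn m : #|[set i in P | rank i < m]| = minn #|P| m.
Proof.
rewrite -card_ord_ltn -(card_imset _ (@enum_val_inj _ (mem P))); apply: eq_card => i.
rewrite inE; apply/andP/imsetP => [[/enum_val_rank[x -> ->] xm]|[x + ->]].
  by exists x; rewrite ?inE.
by rewrite inE rank_enum_val enum_valP.
Qed.

End Rank.

Section Kept.
Variables (n : nat) (a : rel 'I_n) (k : nat).
Hypotheses (a_refl : reflexive a) (a_sym : symmetric a).
Implicit Types i j u v : 'I_n.

Definition class_rank i : nat := rank (class a i) i.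

Definition trimmed : {set 'I_n} := [set i | class_rank i < width k].

Definition rep i : 'I_n := [arg min_(j < i | twin a i j) j].

Definition clique_reps s : {set 'I_n} :=
  [set u | [&& rep u == u, isolated a u & capped_size a k u == s]].

Definition clique_rank i : nat := rank (clique_reps (capped_size a k i)) (rep i).

Definition kept : {set 'I_n} :=
  [set i in trimmed | isolated a i ==> (clique_rank i <= k.*2)].

Definition mixed_reps : {set 'I_n} := [set i | (rep i == i) && ~~ isolated a i].

Lemma truncation_trimmed : truncation a k trimmed.
Proof.
move=> i; rewrite /capped_size -card_rank_ltn; apply: eq_card => j; rewrite !inE.
by case ij: (twin a i j) => //=; rewrite /class_rank (class_eq ij).
Qed.

Lemma twin_rep i : twin a i (rep i).
Proof. by rewrite /rep; case: arg_minnP => //; apply: twin_refl. Qed.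

Lemma rep_min i j : twin a i j -> rep i <= j.
Proof.
by rewrite /rep; case: arg_minnP => [|r _ min_r]; [apply: twin_refl | apply: min_r].
Qed.

Lemma rep_eq i j : twin a i j -> rep i = rep j.
Proof.
move=> ij; apply/val_inj/eqP; rewrite eqn_leq /= !rep_min //.
  by rewrite -(twin_eql ij) twin_rep.
by rewrite (twin_eql ij) twin_rep.
Qed.

Lemma rep_id i : rep (rep i) = rep i.
Proof. by rewrite -(rep_eq (twin_rep i)). Qed.

Lemma rep_inj i j : rep i = i -> rep j = j -> twin a i j -> i = j.
Proof. by move=> ri rj /rep_eq; rewrite ri rj. Qed.

Lemma rep_trimmed i : rep i = i -> i \in trimmed.
Proof.
move=> def_i; rewrite inE /class_rank /rank (_ : [set _ in _ | _] = set0) ?cards0 //.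
apply/setP => j; rewrite !inE; apply/negP => /andP[ij].
by rewrite ltnNge -{1}def_i rep_min.
Qed.

Lemma clique_rank_eq i j : twin a i j -> clique_rank i = clique_rank j.
Proof. by move=> ij; rewrite /clique_rank (rep_eq ij) (capped_size_twin k ij). Qed.

Lemma twin_kept i j : twin a i j -> i \in kept -> j \in trimmed -> j \in kept.
Proof.
move=> ij + jt; rewrite inE => /andP[_]; rewrite (isolated_twin ij) (clique_rank_eq ij).
by rewrite [j \in kept]inE jt.
Qed.

Lemma editable_kept eta : editable a trimmed k eta <-> editable a kept k eta.
Proof.
apply: (editable_drop_cliques a_refl a_sym); first by apply/subsetP => i /setIdP[].
  by move=> i j; apply: twin_kept.
move=> v /setDP[vt]; rewrite inE vt /= negb_imply -ltnNge => /andP[v_iso v_rank].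
pose R := clique_reps (capped_size a k v).
have RP u : u \in R ->
    [/\ rep u = u, isolated a u & capped_size a k u = capped_size a k v].
  by rewrite inE => /and3P[/eqP ? ? /eqP ?].
split=> //; exists [set u in R | rank R u < k.*2.+1]; split.
- apply/subsetP => u /setIdP[/RP[ru u_iso su] u_rank].
  by rewrite inE rep_trimmed // u_iso /clique_rank su ru.
- rewrite card_rank_ltn leq_min leqnn andbT; apply: leq_trans v_rank _.
  by apply/subset_leq_card/subsetP => u /setIdP[].
- by move=> u u' /setIdP[/RP[ru _ _] _] /setIdP[/RP[ru' _ _] _]; apply: rep_inj.
- by move=> u /setIdP[/RP[_ u_iso su] _]; rewrite !truncation_trimmed.
Qed.

(* Each representative is touched itself or has a touched neighbour, namely one  *)
(* that is not its twin; untouched vertices sharing a neighbour are twins.       *)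
Lemma card_mixed_reps eta : editable a setT k eta -> #|mixed_reps| <= 4 * k.
Proof.
case=> l [few _]; pose T := touched a setT l.
have T_card : #|T| <= k.*2 by apply: leq_trans (card_touched _ _ _) few.
have lE x y : x \notin T -> (l x == l y) = a x y by apply: untouched_label; rewrite inE.
rewrite -(cardsID T); have -> : 4 * k = k.*2 + k.*2 by lia.
apply: leq_add; first exact: leq_trans (subset_leq_card (subsetIr _ _)) T_card.
apply: leq_trans T_card; apply: (@leq_card_rel _ _ a) => [i|i j + + y].
  rewrite !inE => /and3P[iT _ /forallPn[j]]; rewrite negb_imply => /andP[ij ntw].
  exists j => //; apply: contraR ntw => jT; move: ij; rewrite -lE // => /eqP ij.
  by apply/twinP => w; rewrite -!lE // ij.
rewrite !inE => /and3P[iT /eqP ri _] /and3P[jT /eqP rj _].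
rewrite -!lE // => /eqP iy /eqP jy; apply: rep_inj => //.
by apply/twinP => w; rewrite -!lE // iy jy.
Qed.

Lemma card_kept : #|mixed_reps| <= 4 * k -> #|kept| <= 64 * (k ^ 3 + 1).
Proof.
move=> mixed_card.
pose few_reps s := [set u in clique_reps s | rank (clique_reps s) u < k.*2.+1].
pose R := mixed_reps :|: \bigcup_(s in [set: 'I_(width k).+1]) few_reps s.
have kept_sub : kept \subset \bigcup_(r in R) (class a r :&: trimmed).
  apply/subsetP => i /setIdP[it i_rank]; apply/bigcupP; exists (rep i); last first.
    by rewrite in_setI it andbT inE twin_sym twin_rep.
  rewrite inE [rep i \in mixed_reps]inE rep_id eqxx -(isolated_twin (twin_rep i)) /=.
  case i_iso: (isolated a i) i_rank => //= i_rank.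
  have lt_size : capped_size a k i < (width k).+1 by rewrite ltnS geq_minr.
  apply/bigcupP; exists (Ordinal lt_size); rewrite ?inE //= rep_id eqxx ltnS i_rank.
  by rewrite -(isolated_twin (twin_rep i)) i_iso (capped_size_twin k (twin_rep i)) eqxx.
have R_card : #|R| <= 4 * k + (width k).+1 * k.*2.+1.
  apply: leq_trans (leq_card_setU _ _) (leq_add mixed_card _).
  rewrite -[X in X * _]card_ord -cardsT; apply: leq_card_bigcup => s _.
  by rewrite card_rank_ltn geq_minr.
apply: leq_trans (subset_leq_card kept_sub) _.
apply: leq_trans (leq_card_bigcup (m := width k) _) _ => [r _|].
  by rewrite truncation_trimmed geq_minr.
apply: leq_trans (leq_mul R_card (leqnn _)) _; rewrite /width.
by case: k => [|[|[|m]]] //; nia.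
Qed.

End Kept.

(** * The kernel *)

Definition star : rel 'I_3 := fun x y => (val x == 0) != (val y == 0).

Definition star_instance : instance := @Instance 3 (graph_of star) 0 0.

Lemma adj_star x y : adj (graph_of star) x y = star x y.
Proof.
rewrite adj_graph_of => [|{}x {}y]; last by rewrite /star eq_sym.
by have [->|] := eqVneq x y; rewrite // /star eqxx.
Qed.

(* The two leaves are adjacent to the centre, but not to each other. *)
Lemma star_no_instance : ~ yes_instance star_instance.
Proof.
move=> /yes_instanceE[l [none _]].
have lE x y : (l x == l y) = nbr (graph_of star) x y.
  apply: (@untouched_label _ _ setT); rewrite ?inE //; apply/negP.
  have : touched (nbr (graph_of star)) setT l = set0.
    by apply/eqP; rewrite -cards_eq0 -leqn0 (leq_trans (card_touched _ _ _)).
  by move=> ->; rewrite inE.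
pose leaf : 'I_3 := Ordinal (isT : 1 < 3).
have := lE leaf ord_max; have := lE ord0 ord_max; have := lE ord0 leaf.
by rewrite /nbr !adj_star /= => /eqP <- /eqP ->; rewrite eqxx.
Qed.

Section Kernel.
Variable I : instance.
Notation n := (nverts I).
Notation k := (budget I).
Notation eta := (imbalance I).
Notation a := (nbr (igraph I)).

Definition accepted : bool :=
  (#|mixed_reps a| <= 4 * k) &&
  (if unforced a k != set0 then shrink a k (trimmed a k) <= eta
   else [forall i in large a k, forall j in large a k,
           deg a setT i <= deg a setT j + eta]).

(* An imbalance of n is no restriction on a graph with n vertices. *)
Definition kernel_imbalance : nat :=
  if unforced a k != set0 then eta - shrink a k (trimmed a k) else n.

Definition kernel_instance : instance :=
  Instance (induced (igraph I) (kept a k)) k kernel_imbalance.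

Definition kernel : instance := if accepted then kernel_instance else star_instance.

Let a_refl := @nbr_refl _ (igraph I).
Let a_sym := @nbr_sym _ (igraph I).
Let truncW := truncation_trimmed a k.

Lemma yes_instance_accepted :
  yes_instance I <-> accepted /\ editable a (trimmed a k) k kernel_imbalance.
Proof.
rewrite /accepted /kernel_imbalance; split=> [/yes_instanceE edI|].
  rewrite (card_mixed_reps edI) /=; case: eqVneq edI => /= [R0|R0] edI.
    have [ev edW] := proj1 (editable_truncation_large a_refl a_sym truncW _ R0) edI.
    rewrite card_ord in edW; split=> //.
    by apply/forall_inP => i iL; apply/forall_inP => j jL; apply: ev.
  by have [] := proj1 (editable_truncation_unforced a_refl a_sym truncW _ R0) edI.
case=> /andP[_]; case: eqVneq => /= [R0 /forall_inP ev edW|R0 le_eta edW].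
  apply/yes_instanceE/(editable_truncation_large a_refl a_sym truncW _ R0).
  by rewrite card_ord; split=> // i j iL jL; apply: (forall_inP (ev i iL)).
by apply/yes_instanceE/(editable_truncation_unforced a_refl a_sym truncW _ R0).
Qed.

Lemma kernel_correct : yes_instance kernel <-> yes_instance I.
Proof.
rewrite yes_instance_accepted /kernel; case: accepted; last first.
  by split=> [/star_no_instance|[]].
rewrite yes_instanceE /= editable_induced.
by rewrite (editable_kept k a_refl a_sym); split=> [|[]].
Qed.

Lemma nverts_kernel : nverts kernel <= 64 * (k ^ 3 + 1).
Proof.
rewrite /kernel /accepted; case: ifP => [/andP[few_mixed _]|_] /=; first exact: card_kept.
by rewrite mulnDr; lia.
Qed.

Lemma nverts_kernel_le : nverts kernel <= maxn n 3.
Proof.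
rewrite /kernel leq_max; case: ifP => _ /=; last by rewrite orbT.
by have := max_card (kept a k); rewrite card_ord => ->.
Qed.

Lemma budget_kernel : budget kernel <= k.
Proof. by rewrite /kernel; case: ifP. Qed.

Lemma imbalance_kernel : imbalance kernel <= maxn eta n.
Proof.
rewrite /kernel; case: ifP => _ //=; rewrite /kernel_imbalance; case: ifP => _; lia.
Qed.

End Kernel.

(** * Polynomial bounds *)

Definition poly_bounded (f : nat -> nat) : Prop :=
  exists c d, forall N, f N <= c * N.+1 ^ d.

Lemma poly_bounded_const c : poly_bounded (fun=> c).
Proof. by exists c, 0 => N; rewrite muln1. Qed.

Lemma poly_bounded_id : poly_bounded id.
Proof. by exists 1, 1 => N; rewrite mul1n expn1 leqnSn. Qed.

Lemma poly_boundedD f g :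
  poly_bounded f -> poly_bounded g -> poly_bounded (fun N => f N + g N).
Proof.
move=> [c [d f_le]] [c' [d' g_le]]; exists (c + c'), (d + d') => N; rewrite mulnDl.
apply: leq_add; [apply: leq_trans (f_le N) _ | apply: leq_trans (g_le N) _].
  by rewrite leq_mul2l leq_pexp2l ?leq_addr ?orbT.
by rewrite leq_mul2l leq_pexp2l ?leq_addl ?orbT.
Qed.

Lemma poly_boundedM f g :
  poly_bounded f -> poly_bounded g -> poly_bounded (fun N => f N * g N).
Proof.
move=> [c [d f_le]] [c' [d' g_le]]; exists (c * c'), (d + d') => N.
by rewrite expnD mulnACA leq_mul.
Qed.

Create HintDb poly_bounded.
#[local] Hint Resolve
  poly_bounded_const poly_bounded_id poly_boundedD poly_boundedM : poly_bounded.

(** * Time-bounded execution *)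

Implicit Types (s : state) (r x d : nat) (c : cmd) (Q : state -> Prop).

Definition runs c s T Q : Prop := exists t s', [/\ exec c s t s', t <= T & Q s'].

Lemma runs_exec c s t s' Q : exec c s t s' -> Q s' -> runs c s t Q.
Proof. by exists t, s'. Qed.

Lemma runs_seq c1 c2 s T1 T2 Q1 Q2 :
  runs c1 s T1 Q1 -> (forall s', Q1 s' -> runs c2 s' T2 Q2) ->
  runs (Seq c1 c2) s (T1 + T2) Q2.
Proof.
move=> [t [s1 [x1 l1 q1]]] /(_ _ q1) [u [s2 [x2 l2 q2]]].
by exists (t + u), s2; split; [exact: exec_seq x1 x2 | exact: leq_add |].
Qed.

Lemma runs_if r c1 c2 s T1 T2 Q :
  (regs s r != 0 -> runs c1 s T1 Q) -> (regs s r = 0 -> runs c2 s T2 Q) ->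
  runs (If r c1 c2) s (T1 + T2 + 1) Q.
Proof.
move=> run1 run2; have [/[dup] r0 /run2|/[dup] r0 /run1] := eqVneq (regs s r) 0.
  by move=> [t [s' [x l q]]]; exists t.+1, s'; split; [exact: exec_if_false | lia |].
by move=> [t [s' [x l q]]]; exists t.+1, s'; split; [exact: exec_if_true | lia |].
Qed.

Lemma runs_weaken c s T T' Q Q' :
  T <= T' -> (forall s', Q s' -> Q' s') -> runs c s T Q -> runs c s T' Q'.
Proof.
move=> lT QQ [t [s' [x l q]]]; exists t, s'; split=> //; last exact: QQ.
exact: leq_trans lT.
Qed.

Lemma runs_while r c T (Inv : nat -> state -> Prop) :
  (forall j s, Inv j s -> regs s r = j) ->
  (forall j s, Inv j.+1 s -> runs c s T (Inv j)) ->
  forall j s, Inv j s -> runs (While r c) s (j * T.+1 + 1) (Inv 0).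
Proof.
move=> InvE step; elim=> [|j IHj] s Is.
  by exists 1, s; split=> //; apply: exec_while_stop; apply: InvE.
have [t [s1 [x1 l1 /IHj[u [s2 [x2 l2 q2]]]]]] := step _ _ Is.
exists (t + u).+1, s2; split=> //; last by rewrite mulSn; lia.
by apply: exec_while_loop x1 x2; rewrite (InvE _ _ Is).
Qed.

Lemma upd_eq f x v : upd f x v x = v. Proof. by rewrite /upd eqxx. Qed.

Lemma upd_neq f x v y : y != x -> upd f x v y = f y.
Proof. by rewrite /upd => /negbTE ->. Qed.

Definition same_below d s s' : Prop :=
  memory s' = memory s /\ forall x, x < d -> regs s' x = regs s x.

(* Registers from [d] on are scratch space, and may be clobbered. *)
Definition sets d r v s s' : Prop :=
  [/\ regs s' r = v, memory s' = memory s &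
      forall x, x < d -> x != r -> regs s' x = regs s x].

Lemma same_below_trans d s1 s2 s3 :
  same_below d s1 s2 -> same_below d s2 s3 -> same_below d s1 s3.
Proof. by move=> [m12 r12] [m23 r23]; split=> [|x xd]; rewrite ?m23 // r23 ?r12. Qed.

Lemma same_belowW d d' s s' : d <= d' -> same_below d' s s' -> same_below d s s'.
Proof. by move=> dd' [m r]; split=> // x xd; apply: r; apply: leq_trans dd'. Qed.

Lemma sets_same_below d d' r v s s' :
  d' <= d -> d' <= r -> sets d r v s s' -> same_below d' s s'.
Proof. by move=> dd' dr [_ m eq_s]; split=> // x xd; apply: eq_s; lia. Qed.

Lemma sets_set_reg d r v s : sets d r v s (set_reg s r v).
Proof. by split=> //= [|x _ xr]; rewrite ?upd_eq ?upd_neq. Qed.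

Lemma sets_after d v s s1 s2 : same_below d s s1 -> sets d d v s1 s2 -> sets d d v s s2.
Proof.
move=> s01 s12; have s12' := sets_same_below (leqnn d) (leqnn d) s12.
have [eq_mem eq_regs] := same_below_trans s01 s12'.
by case: s12 => <- _ _; split=> // x xd _; apply: eq_regs.
Qed.

Definition copy r x : cmd := Seq (Const r 0) (Add r r x).

Definition decr r : cmd := Seq (Const r.+1 1) (Defs.Sub r r r.+1).

Definition loop r c : cmd := Seq (copy r 0) (While r (Seq (decr r) c)).

Definition loop_time T N : nat := 2 + (N * (2 + T).+1 + 1).

Lemma poly_bounded_loop T :
  poly_bounded T -> poly_bounded (fun N => loop_time (T N) N).
Proof.
move=> polyT; have : poly_bounded (fun N => 2 + (N * (3 + T N) + 1)).
  by auto 10 with poly_bounded.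
exact.
Qed.

Lemma runs_const d r v s : runs (Const r v) s 1 (sets d r v s).
Proof. exact: runs_exec (exec_const _ _ _) (sets_set_reg _ _ _ _). Qed.

Lemma runs_copy d r x s : x != r -> runs (copy r x) s 2 (sets d r (regs s x) s).
Proof.
move=> xr; apply: runs_exec (exec_seq (exec_const _ _ _) (exec_add _ _ _ _)) _.
split=> //= [|y _ yr]; last by rewrite !upd_neq.
by rewrite !upd_eq upd_neq.
Qed.

Lemma runs_decr r s : runs (decr r) s 2 (sets r.+1 r (regs s r).-1 s).
Proof.
apply: runs_exec (exec_seq (exec_const _ _ _) (exec_sub _ _ _ _)) _.
split=> //= [|x xr nxr]; last by rewrite !upd_neq //; lia.
by rewrite !upd_eq upd_neq ?subn1 //; lia.
Qed.

(* [Inv] may not mention the counter, so it is indexed by the counter's value. *)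
Lemma runs_loop r c T (Inv : nat -> state -> Prop) s : 0 < r ->
  (forall j s1 s2, same_below r s1 s2 -> Inv j s1 -> Inv j s2) ->
  (forall j s1, j < regs s 0 -> regs s1 r = j -> Inv j.+1 s1 ->
     runs c s1 T (fun s2 => regs s2 r = j /\ Inv j s2)) ->
  Inv (regs s 0) s ->
  runs (loop r c) s (loop_time T (regs s 0)) (Inv 0).
Proof.
move=> r0 Inv_same step Inv_s; have copied := @runs_copy r r 0 s _.
apply: runs_seq (copied _) _ => [|s1 s01]; first by rewrite neq_ltn r0.
pose Inv' j s' := [/\ regs s' r = j, j <= regs s 0 & Inv j s'].
apply: runs_weaken (@runs_while r _ (2 + T) Inv' _ _ (regs s 0) s1 _) => //.
- by move=> s2 [].
- by move=> j s2 [].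
- move=> j s2 [s2r jn Inv_s2]; apply: runs_seq (runs_decr r s2) _ => s3 s23.
  have s3r : regs s3 r = j by case: s23 => ->; rewrite s2r.
  apply: runs_weaken (step j s3 jn s3r _) => // [s4 [s4r Inv_s4]|].
    by split=> //; apply: ltnW.
  by apply: Inv_same Inv_s2; apply: sets_same_below s23.
have [s1r _ _] := s01; split=> //.
by apply: Inv_same Inv_s; apply: sets_same_below s01.
Qed.

(** * Expressions with bounded sums *)

Definition nglob : nat := 6.

(* Variables are de Bruijn indices bound by [Sum], globals are registers. *)
Inductive expr : Type :=
| Var (i : nat)
| Glob (r : nat)
| Lit (v : nat)
| Plus (e1 e2 : expr)
| Minus (e1 e2 : expr)
| Mem (e : expr)
| Cond (e e1 e2 : expr)
| Sum (e : expr).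

Fixpoint eval s (vs : seq nat) (e : expr) : nat :=
  match e with
  | Var i => nth 0 vs i
  | Glob r => if r < nglob then regs s r else 0
  | Lit v => v
  | Plus e1 e2 => eval s vs e1 + eval s vs e2
  | Minus e1 e2 => eval s vs e1 - eval s vs e2
  | Mem e => memory s (eval s vs e)
  | Cond e e1 e2 => if eval s vs e != 0 then eval s vs e1 else eval s vs e2
  | Sum e => \sum_(j < regs s 0) eval s (val j :: vs) e
  end.

Fixpoint compile (vars : seq nat) d (e : expr) : cmd :=
  match e with
  | Var i => if i < size vars then copy d (nth 0 vars i) else Const d 0
  | Glob r => if r < nglob then copy d r else Const d 0
  | Lit v => Const d v
  | Plus e1 e2 => Seq (compile vars d e1) (Seq (compile vars d.+1 e2) (Add d d d.+1))
  | Minus e1 e2 =>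
      Seq (compile vars d e1) (Seq (compile vars d.+1 e2) (Defs.Sub d d d.+1))
  | Mem e => Seq (compile vars d e) (Read d d)
  | Cond e e1 e2 => Seq (compile vars d e) (If d (compile vars d e1) (compile vars d e2))
  | Sum e =>
      Seq (Const d 0)
        (loop d.+1 (Seq (compile (d.+1 :: vars) d.+2 e) (Add d d d.+2)))
  end.

Fixpoint time (e : expr) N : nat :=
  match e with
  | Var _ | Glob _ => 2
  | Lit _ => 1
  | Plus e1 e2 | Minus e1 e2 => time e1 N + (time e2 N + 1)
  | Mem e => time e N + 1
  | Cond e e1 e2 => time e N + (time e1 N + time e2 N + 1)
  | Sum e => 1 + loop_time (time e N + 1) N
  end.

Lemma poly_bounded_time e : poly_bounded (time e).
Proof.
elim: e => /= *; try by auto 10 with poly_bounded.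
apply: poly_boundedD; first exact: poly_bounded_const.
by apply: poly_bounded_loop; auto with poly_bounded.
Qed.

Lemma eval_same_below d s s' vs e :
  nglob <= d -> same_below d s s' -> eval s' vs e = eval s vs e.
Proof.
move=> nd [eq_mem eq_regs]; have eq_glob r : r < nglob -> regs s' r = regs s r.
  by move=> rn; apply: eq_regs; apply: leq_trans nd.
elim: e vs => //= [r|e1 IH1 e2 IH2|e1 IH1 e2 IH2|e IHe|e IHe e1 IH1 e2 IH2|e IHe] vs.
- by case: ifP => // /eq_glob.
- by rewrite IH1 IH2.
- by rewrite IH1 IH2.
- by rewrite IHe eq_mem.
- by rewrite IHe IH1 IH2.
- by rewrite eq_glob //; apply: eq_bigr => j _; apply: IHe.
Qed.

Lemma map_same_below d s s' vars : all (gtn d) vars -> same_below d s s' ->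
  map (regs s') vars = map (regs s) vars.
Proof. by move=> /allP vars_d [_ eq_regs]; apply/eq_in_map => x /vars_d /eq_regs. Qed.

Definition compiles (e : expr) : Prop := forall vars d s,
  nglob <= d -> all (gtn d) vars ->
  runs (compile vars d e) s (time e (regs s 0))
    (sets d d (eval s (map (regs s) vars) e) s).

Lemma compiles_after e vars d d' s s' : compiles e ->
  nglob <= d -> all (gtn d) vars -> d <= d' -> same_below d s s' ->
  runs (compile vars d' e) s' (time e (regs s 0))
    (sets d' d' (eval s (map (regs s) vars) e) s').
Proof.
move=> ce nd vars_d dd' ss'; rewrite -(eval_same_below _ _ nd ss').
rewrite -(map_same_below vars_d ss') -(proj2 ss' 0); last exact: leq_trans nd.
apply: ce; first exact: leq_trans dd'.
by apply: sub_all vars_d => x /= xd; apply: leq_trans dd'.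
Qed.

Lemma runs_binop (op : nat -> nat -> nat) (instr : nat -> nat -> nat -> cmd)
    e1 e2 vars d s :
  (forall s r x y, exec (instr r x y) s 1 (set_reg s r (op (regs s x) (regs s y)))) ->
  compiles e1 -> compiles e2 -> nglob <= d -> all (gtn d) vars ->
  runs (Seq (compile vars d e1) (Seq (compile vars d.+1 e2) (instr d d d.+1)))
    s (time e1 (regs s 0) + (time e2 (regs s 0) + 1))
    (sets d d (op (eval s (map (regs s) vars) e1) (eval s (map (regs s) vars) e2)) s).
Proof.
move=> exec_instr c1 c2 nd vars_d; apply: runs_seq (c1 _ _ _ nd vars_d) _ => s1 s01.
have same1 : same_below d s s1 by apply: sets_same_below s01.
apply: runs_seq (compiles_after c2 nd vars_d (leqnSn d) same1) _ => s2 s12.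
have same2 : same_below d.+1 s1 s2 by apply: sets_same_below s12.
apply: runs_exec (exec_instr _ _ _ _) _; apply: sets_after (same_below_trans same1 _) _.
  exact: same_belowW same2.
have [<- _ _] := s01; have [<- _ _] := s12; rewrite -(proj2 same2 d) //.
exact: sets_set_reg.
Qed.

Lemma compiles_sum e : compiles e -> compiles (Sum e).
Proof.
move=> ce vars d s nd vars_d /=; set F := fun j => eval s (j :: map (regs s) vars) e.
pose Inv j s' :=
  same_below d s s' /\ regs s' d + \sum_(i < j) F i = \sum_(i < regs s 0) F i.
have nd1 : nglob <= d.+1 := leqW nd.
apply: runs_seq (runs_const d.+1 d 0 s) _ => s1 s01.
have same1 : same_below d s s1 by apply: sets_same_below s01.
have s1_0 : regs s1 0 = regs s 0 by apply: (proj2 same1); apply: leq_trans nd.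
have := @runs_loop d.+1 _ (time e (regs s 0) + 1) Inv s1; rewrite s1_0 => run_loop.
apply: runs_weaken (run_loop _ _ _ _ _) => //.
- move=> s2 [[eq_mem eq_regs] sum2]; split=> // [|x xd _]; last exact: eq_regs.
  by rewrite -sum2 big_ord0 addn0.
- move=> j s2 s3 same23 [same2 sum2]; split; last by rewrite (proj2 same23 d).
  exact: same_below_trans same2 (same_belowW _ same23).
- move=> j s2 lt_j s2d [same2 sum2].
  have vars_d1 : all (gtn d.+2) (d.+1 :: vars).
    by rewrite /= leqnn; apply: sub_all vars_d => x /=; lia.
  have := ce _ d.+2 s2 (leqW nd1) vars_d1.
  rewrite (proj2 same2 0) ?(leq_trans _ nd) // => run_e.
  apply: runs_seq run_e _ => s3 s23.
  have same3 : same_below d.+2 s2 s3 by apply: sets_same_below s23.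
  apply: runs_exec (exec_add _ _ _ _) _; split.
    by rewrite /= upd_neq ?(proj2 same3) //; lia.
  split.
    apply: same_below_trans same2 (same_below_trans (same_belowW _ same3) _); first lia.
    by apply: sets_same_below (sets_set_reg d _ _ _).
  rewrite /= upd_eq; case: s23 => -> _ _; rewrite (proj2 same3 d) //= s2d.
  rewrite (eval_same_below _ _ nd same2) (map_same_below vars_d same2) -/(F j).
  by rewrite -sum2 big_ord_recr addnAC -addnA.
by split=> //; case: s01 => ->; rewrite add0n.
Qed.

Lemma compileP e : compiles e.
Proof.
elim: e => [i|r|v|e1 c1 e2 c2|e1 c1 e2 c2|e ce|e ce e1 c1 e2 c2|e ce].
- move=> vars d s nd vars_d /=; case: ltnP => iv; last first.
    by rewrite nth_default ?size_map //; apply: runs_weaken (runs_const d d 0 s).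
  have /= lt_d := allP vars_d _ (mem_nth 0 iv).
  by rewrite (nth_map 0) //; apply: runs_copy; rewrite neq_ltn lt_d.
- move=> vars d s nd _ /=; case: ifP => rn; last exact: runs_weaken (runs_const d d 0 s).
  by apply: runs_copy; rewrite neq_ltn (leq_trans rn).
- by move=> vars d s _ _; apply: runs_const.
- by move=> vars d s nd vars_d; apply: runs_binop exec_add c1 c2 nd vars_d.
- by move=> vars d s nd vars_d; apply: runs_binop exec_sub c1 c2 nd vars_d.
- move=> vars d s nd vars_d; apply: runs_seq (ce _ _ _ nd vars_d) _ => s1 s01.
  apply: runs_exec (exec_read _ _ _) _.
  apply: sets_after (sets_same_below _ _ s01) _ => //=.
  by case: s01 => <- <- _; apply: sets_set_reg.
- move=> vars d s nd vars_d; apply: runs_seq (ce _ _ _ nd vars_d) _ => s1 s01.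
  have same1 : same_below d s s1 by apply: sets_same_below s01.
  have after v s2 := @sets_after d v s s1 s2 same1.
  have [s1d _ _] := s01; apply: runs_if; rewrite s1d => cond /=; rewrite cond /=.
    by apply: runs_weaken (after _) (compiles_after c1 nd vars_d (leqnn d) same1).
  by apply: runs_weaken (after _) (compiles_after c2 nd vars_d (leqnn d) same1).
- exact: compiles_sum.
Qed.

Declare Scope expr_scope.
Delimit Scope expr_scope with expr.
Bind Scope expr_scope with expr.

Definition Not e := Minus (Lit 1) e.
Definition And e1 e2 := Cond e1 e2 (Lit 0).
Definition Imp e1 e2 := Cond e1 e2 (Lit 1).
Definition Leq e1 e2 := Not (Minus e1 e2).
Definition Ltn e1 e2 := Leq (Plus e1 (Lit 1)) e2.
Definition Eqn e1 e2 := And (Leq e1 e2) (Leq e2 e1).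
Definition Exists e := Ltn (Lit 0) (Sum e).
Definition Forall e := Not (Exists (Not e)).
Definition Min e1 e2 := Cond (Leq e1 e2) e1 e2.

Notation "e1 + e2" := (Plus e1 e2) : expr_scope.
Notation "e1 - e2" := (Minus e1 e2) : expr_scope.
Notation "~~ e" := (Not e) : expr_scope.
Notation "e1 && e2" := (And e1 e2) : expr_scope.
Notation "e1 ==> e2" := (Imp e1 e2) : expr_scope.
Notation "e1 <= e2" := (Leq e1 e2) : expr_scope.
Notation "e1 < e2" := (Ltn e1 e2) : expr_scope.
Notation "e1 == e2" := (Eqn e1 e2) : expr_scope.

Section Connectives.
Variable s : state.
Notation ev := (eval s).
Implicit Type p : bool.

Lemma eval_cond vs e e1 e2 p : ev vs e = p ->
  ev vs (Cond e e1 e2) = if p then ev vs e1 else ev vs e2.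
Proof. by move=> /= ->; case: p. Qed.

Lemma eval_not vs e p : ev vs e = p -> ev vs (Not e) = ~~ p.
Proof. by move=> /= ->; case: p. Qed.

Lemma eval_and vs e1 e2 p1 p2 : ev vs e1 = p1 -> ev vs e2 = p2 ->
  ev vs (And e1 e2) = p1 && p2.
Proof. by move=> /= -> ->; case: p1. Qed.

Lemma eval_imp vs e1 e2 p1 p2 : ev vs e1 = p1 -> ev vs e2 = p2 ->
  ev vs (Imp e1 e2) = (p1 ==> p2).
Proof. by move=> /= -> ->; case: p1. Qed.

Lemma eval_plus vs e1 e2 x y : ev vs e1 = x -> ev vs e2 = y ->
  ev vs (Plus e1 e2) = x + y.
Proof. by move=> /= -> ->. Qed.

Lemma eval_leq vs e1 e2 x y : ev vs e1 = x -> ev vs e2 = y ->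
  ev vs (Leq e1 e2) = (x <= y).
Proof. by move=> /= -> ->; lia. Qed.

Lemma eval_ltn vs e1 e2 x y : ev vs e1 = x -> ev vs e2 = y ->
  ev vs (Ltn e1 e2) = (x < y).
Proof. by move=> /= -> ->; lia. Qed.

Lemma eval_eqn vs e1 e2 x y : ev vs e1 = x -> ev vs e2 = y ->
  ev vs (Eqn e1 e2) = (x == y).
Proof. by move=> ev1 ev2; rewrite eqn_leq; apply: eval_and; apply: eval_leq. Qed.

Lemma eval_eqb vs e1 e2 p1 p2 : ev vs e1 = p1 -> ev vs e2 = p2 ->
  ev vs (Eqn e1 e2) = (p1 == p2).
Proof. by move=> ev1 ev2; rewrite (eval_eqn ev1 ev2); case: p1 ev1; case: p2 ev2. Qed.

Lemma eval_min vs e1 e2 x y : ev vs e1 = x -> ev vs e2 = y ->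
  ev vs (Min e1 e2) = minn x y.
Proof.
by move=> ev1 ev2; rewrite (eval_cond _ _ (eval_leq ev1 ev2)) ev1 ev2; case: leqP.
Qed.

End Connectives.

(** * Assignments and matrices *)

Definition assign r e : cmd := Seq (compile [::] nglob e) (copy r nglob).

Lemma runs_assign r e s : r < nglob ->
  runs (assign r e) s (time e (regs s 0) + 2) (sets nglob r (eval s [::] e) s).
Proof.
move=> rn; apply: runs_seq (@compileP e [::] nglob s _ _) _ => // s1 s01.
have same1 : same_below nglob s s1 by apply: sets_same_below s01.
have nglob_r : nglob != r by rewrite neq_ltn rn orbT.
apply: runs_weaken (runs_copy nglob s1 nglob_r) => // s2 [s2r m2 regs2].
split=> [||x xn xr]; first by rewrite s2r; case: s01.
  by rewrite m2; case: same1.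
by rewrite regs2 //; apply: (proj2 same1).
Qed.

Definition square_expr : expr := Sum (Glob 0).

Definition cell_expr i j : expr := Sum (Var i.+1) + Var j.

Lemma eval_square s vs : eval s vs square_expr = regs s 0 * regs s 0.
Proof. by rewrite /= sum_nat_const card_ord. Qed.

Lemma eval_cell s vs i j :
  eval s vs (cell_expr i j) = nth 0 vs i * regs s 0 + nth 0 vs j.
Proof. by rewrite /= sum_nat_const card_ord mulnC. Qed.

Lemma cell_inj m x y x' y' : y < m -> y' < m ->
  x * m + y = x' * m + y' -> x = x' /\ y = y'.
Proof.
move=> ym y'm eq_cell; have m0 : 0 < m by apply: leq_trans ym.
have := congr1 (divn^~ m) eq_cell; have := congr1 (modn^~ m) eq_cell.
by rewrite /= !modnMDl !divnMDl // !modn_small // !divn_small // !addn0.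
Qed.

Lemma ltn_cell m x y : x < m -> y < m -> x * m + y < m * m.
Proof. by move=> xm ym; nia. Qed.

Definition fill_cell (base e : expr) : cmd :=
  Seq (compile [:: nglob.+1; nglob] nglob.+2 (base + cell_expr 1 0)%expr)
    (Seq (compile [:: nglob.+1; nglob] nglob.+3 e) (Write nglob.+2 nglob.+3)).

Definition fill (base e : expr) : cmd := loop nglob (loop nglob.+1 (fill_cell base e)).

Definition time_fill_cell (base e : expr) N : nat :=
  time (base + cell_expr 1 0) N + (time e N + 1).

Definition time_fill (base e : expr) N : nat :=
  loop_time (loop_time (time_fill_cell base e N) N) N.

Lemma poly_bounded_fill base e : poly_bounded (time_fill base e).
Proof.
apply/poly_bounded_loop/poly_bounded_loop/poly_boundedD; first exact: poly_bounded_time.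
by apply: poly_boundedD; [exact: poly_bounded_time | exact: poly_bounded_const].
Qed.

Section Fill.
Variables (s : state) (base e : expr) (b : nat) (v : nat -> nat).
Let n := regs s 0.

Definition filled p s' : Prop :=
  (forall r, r < nglob -> regs s' r = regs s r) /\
  forall q, memory s' q = if b + p <= q < b + n * n then v (q - b) else memory s q.

Hypothesis eval_base : forall x y s', x < n -> y < n -> filled (x * n + y).+1 s' ->
  eval s' [:: y; x] base = b.
Hypothesis eval_value : forall x y s', x < n -> y < n -> filled (x * n + y).+1 s' ->
  eval s' [:: y; x] e = v (x * n + y).

Lemma filled_same_below p s1 s2 : same_below nglob s1 s2 -> filled p s1 -> filled p s2.
Proof.
move=> [m12 regs12] [regs1 m1]; split=> [r rn|q]; last by rewrite m12.
by rewrite regs12 ?regs1.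
Qed.

Lemma runs_fill_cell x y s1 : x < n -> y < n ->
  regs s1 nglob = x -> regs s1 nglob.+1 = y -> filled (x * n + y).+1 s1 ->
  runs (fill_cell base e) s1 (time_fill_cell base e n)
    (fun s2 => regs s2 nglob.+1 = y /\ regs s2 nglob = x /\ filled (x * n + y) s2).
Proof.
move=> xn yn s1x s1y filled1; set p := x * n + y in filled1 *.
have lt_p : p < n * n by apply: ltn_cell.
have s1_0 : regs s1 0 = n by apply: (proj1 filled1).
pose vars := [:: nglob.+1; nglob].
have vars_s1 : map (regs s1) vars = [:: y; x] by rewrite /= s1x s1y.
have eval_addr : eval s1 [:: y; x] (base + cell_expr 1 0) = b + p.
  by apply: eval_plus; [exact: eval_base | rewrite eval_cell s1_0].
have run_addr := @compileP (base + cell_expr 1 0) vars nglob.+2 s1 isT isT.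
rewrite s1_0 vars_s1 eval_addr in run_addr.
apply: runs_seq run_addr _ => s2 s12.
have same2 : same_below nglob.+2 s1 s2 by apply: sets_same_below s12.
have run_value := @compiles_after e vars nglob.+2 nglob.+3 s1 s2
  (@compileP e) isT isT isT same2.
rewrite s1_0 vars_s1 (eval_value xn yn filled1) in run_value.
apply: runs_seq run_value _ => s3 s23.
have same3 : same_below nglob.+2 s1 s3.
  by apply: (same_below_trans same2); apply: sets_same_below s23.
apply: runs_exec (exec_write _ _ _) _; split; first by rewrite /= (proj2 same3).
split; first by rewrite /= (proj2 same3).
have addr : regs s3 nglob.+2 = b + p by case: s23 => _ _ ->; case: s12.
have val3 : regs s3 nglob.+3 = v p by case: s23.
rewrite /= addr val3; split=> [r rn|q] /=.
  by rewrite (proj2 same3) ?(proj1 filled1) //; apply: leq_trans rn _.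
have [->|nq] := eqVneq q (b + p).
  by rewrite upd_eq leqnn ltn_add2l lt_p addKn.
rewrite upd_neq // (proj1 same3) (proj2 filled1) addnS.
by rewrite [b + p <= q]leq_eqVlt eq_sym (negbTE nq).
Qed.

Lemma runs_fill : runs (fill base e) s (time_fill base e n) (filled 0).
Proof.
apply: (@runs_loop _ _ _ (fun x => filled (x * n))) => //.
- by move=> x s1 s2; apply: filled_same_below.
- move=> x s1 xn s1x filled1; have s1_0 : regs s1 0 = n by apply: (proj1 filled1).
  pose Inv y s' := regs s' nglob = x /\ filled (x * n + y) s'.
  have := @runs_loop nglob.+1 _ (time_fill_cell base e n) Inv s1; rewrite s1_0 => run_row.
  apply: runs_weaken (run_row _ _ _ _ _) => //.
  + by move=> s2; rewrite /Inv addn0.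
  + move=> y s2 s3 same23 [s2x filled2]; split; first by rewrite (proj2 same23).
    by apply: filled_same_below (same_belowW _ same23) filled2.
  + move=> y s2 yn s2y [s2x]; rewrite addnS => filled2.
    exact: runs_fill_cell.
  + by split=> //; rewrite addnC -mulSn.
split=> // q; case: ifP => //; lia.
Qed.

End Fill.

(** * Expressions for the kernel *)

(* An argument [i] stands for the vertex [Var i]; every [Sum], [Exists] and       *)
(* [Forall] shifts the indices in its scope by one.                               *)
Definition rank_expr member bound : expr := Sum (member && (Var 0 < bound)).
Definition adj_expr i j : expr := Mem (cell_expr i j).
Definition nbr_expr i j : expr := Cond (Var i == Var j) (Lit 1) (adj_expr i j).
Definition twin_expr i j : expr := Forall (nbr_expr i.+1 0 == nbr_expr j.+1 0).
Definition isolated_expr i : expr := Forall (nbr_expr i.+1 0 ==> twin_expr i.+1 0).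
Definition class_size_expr i : expr := Sum (twin_expr i.+1 0).
Definition twice_budget_expr : expr := Glob 1 + Glob 1.
Definition width_expr : expr := twice_budget_expr + twice_budget_expr + Lit 1.
Definition capped_size_expr i : expr := Min (class_size_expr i) width_expr.
Definition large_expr i : expr := twice_budget_expr < class_size_expr i.
Definition unforced_expr i : expr := Forall (large_expr 0 ==> ~~ nbr_expr i.+1 0).
Definition has_unforced_expr : expr := Exists (unforced_expr 0).
Definition class_rank_expr i : expr := rank_expr (twin_expr i.+1 0) (Var i.+1).
Definition trimmed_expr i : expr := class_rank_expr i < width_expr.
Definition deg_expr i : expr := Sum (nbr_expr i.+1 0).
Definition deg_trimmed_expr i : expr := Sum (trimmed_expr 0 && nbr_expr i.+1 0).
(* A maximum of numbers up to n is the number of j that are below one of them. *)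
Definition maxdeg_expr deg : expr := Sum (Exists (large_expr 0 && (Var 1 < deg))).
Definition shrink_expr : expr :=
  maxdeg_expr (deg_expr 0) - maxdeg_expr (deg_trimmed_expr 0).
(* Likewise the least twin of i is the number of j that are below all of them. *)
Definition rep_expr i : expr := Sum (Forall (twin_expr i.+2 0 ==> (Var 1 < Var 0))).
Definition is_rep_expr i : expr := rep_expr i == Var i.
Definition clique_rank_expr i : expr :=
  rank_expr (is_rep_expr 0 && (isolated_expr 0 &&
               (capped_size_expr 0 == capped_size_expr i.+1)))
    (rep_expr i.+1).
Definition kept_expr i : expr :=
  trimmed_expr i && (isolated_expr i ==> (clique_rank_expr i <= twice_budget_expr)).
Definition card_mixed_expr : expr := Sum (is_rep_expr 0 && ~~ isolated_expr 0).
Definition accepted_expr : expr :=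
  (card_mixed_expr <= twice_budget_expr + twice_budget_expr) &&
  Cond has_unforced_expr (shrink_expr <= Glob 2)
    (Forall (large_expr 0 ==>
       Forall (large_expr 0 ==> (deg_expr 1 <= deg_expr 0 + Glob 2)))).
Definition kernel_imbalance_expr : expr :=
  Cond has_unforced_expr (Glob 2 - shrink_expr) (Glob 0).
Definition card_kept_expr : expr := Sum (kept_expr 0).
Definition kept_rank_expr i : expr := rank_expr (kept_expr 0) (Var i.+1).
(* Entry (x_1, x_0) of an n x n matrix that holds the kernel's adjacency matrix,  *)
(* whose rows are shorter, in row-major order.                                    *)
Definition kernel_cell_expr : expr :=
  Exists (kept_expr 0 && Exists (kept_expr 0 && (
    (cell_expr 3 2 ==
       Sum (Cond (kept_expr 0) (kept_rank_expr 2) (Lit 0)) + kept_rank_expr 0)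
    && adj_expr 1 0))).
Definition star_expr : expr := ~~ ((Var 1 == Lit 0) == (Var 0 == Lit 0)).

Section Evaluation.
Variables (I : instance) (s : state).
Hypothesis sI : output_state s I.
Notation n := (nverts I).
Notation k := (budget I).
Notation eta := (imbalance I).
Notation G := (igraph I).
Notation a := (nbr G).
Notation ev := (eval s).
Implicit Types (vs : seq nat) (i j : nat) (u v w : 'I_n).

Let s_n : regs s 0 = n. Proof. by case: sI. Qed.
Let s_k : regs s 1 = k. Proof. by case: sI. Qed.
Let s_eta : regs s 2 = eta. Proof. by case: sI. Qed.

Lemma eval_sum vs e (F : 'I_n -> nat) : (forall w, ev (val w :: vs) e = F w) ->
  ev vs (Sum e) = \sum_w F w.
Proof.
move=> eF; rewrite /= -(big_mkord xpredT (fun j => ev (j :: vs) e)) s_n big_mkord.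
by apply: eq_bigr => w _; apply: eF.
Qed.

Lemma eval_count vs e (p : pred 'I_n) :
  (forall w, ev (val w :: vs) e = p w) -> ev vs (Sum e) = #|[set w | p w]|.
Proof.
move=> ep; rewrite (eval_sum ep) -sum1dep_card [RHS]big_mkcond.
by apply: eq_bigr => w _; case: (p w).
Qed.

Lemma eval_exists vs e (p : pred 'I_n) :
  (forall w, ev (val w :: vs) e = p w) -> ev vs (Exists e) = [exists w, p w].
Proof.
move=> ep; rewrite (eval_ltn (x := 0) _ (eval_count ep)) //; congr nat_of_bool.
by apply/card_gt0P/existsP => -[w]; rewrite ?inE => pw; exists w; rewrite ?inE.
Qed.

Lemma eval_forall vs e (p : pred 'I_n) :
  (forall w, ev (val w :: vs) e = p w) -> ev vs (Forall e) = [forall w, p w].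
Proof.
move=> ep; rewrite (eval_not (p := [exists w, ~~ p w])).
  by rewrite -negb_forall negbK.
by apply: eval_exists => w; apply: eval_not.
Qed.

Lemma eval_rank vs member bound (P : {set 'I_n}) m :
  (forall w, ev (val w :: vs) member = (w \in P)) ->
  (forall w, ev (val w :: vs) bound = m) -> ev vs (rank_expr member bound) = rank P m.
Proof.
move=> eP em; apply: (eval_count (p := fun w => (w \in P) && (w < m))) => w.
by apply: eval_and; last apply: eval_ltn.
Qed.

Lemma eval_adj vs i j u v : nth 0 vs i = u -> nth 0 vs j = v ->
  ev vs (adj_expr i j) = adj G u v.
Proof.
move=> iu jv; have [_ _ _ <-] := sI.
by rewrite -[LHS]/(memory s (ev vs (cell_expr i j))) eval_cell s_n iu jv.
Qed.

Lemma eval_nbr vs i j u v : nth 0 vs i = u -> nth 0 vs j = v ->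
  ev vs (nbr_expr i j) = a u v.
Proof.
move=> iu jv; have eq_uv : ev vs (Var i == Var j)%expr = (u == v) by apply: eval_eqn.
by rewrite (eval_cond _ _ eq_uv) (eval_adj iu jv) /nbr; case: eqP.
Qed.

Lemma eval_twin vs i j u v : nth 0 vs i = u -> nth 0 vs j = v ->
  ev vs (twin_expr i j) = twin a u v.
Proof.
move=> iu jv; apply: eval_forall => w.
by apply: eval_eqb; apply: eval_nbr.
Qed.

Lemma eval_isolated vs i u : nth 0 vs i = u -> ev vs (isolated_expr i) = isolated a u.
Proof.
move=> iu; apply: eval_forall => w.
by apply: eval_imp; [apply: eval_nbr | apply: eval_twin].
Qed.

Lemma eval_class_size vs i u : nth 0 vs i = u -> ev vs (class_size_expr i) = #|class a u|.
Proof. by move=> iu; apply: eval_count => w; apply: eval_twin. Qed.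

Lemma eval_twice_budget vs : ev vs twice_budget_expr = k.*2.
Proof. by rewrite /= s_k addnn. Qed.

Lemma eval_width vs : ev vs width_expr = width k.
Proof. by rewrite /= s_k /width; lia. Qed.

Lemma eval_capped_size vs i u : nth 0 vs i = u ->
  ev vs (capped_size_expr i) = capped_size a k u.
Proof. by move=> iu; apply: eval_min; [apply: eval_class_size | apply: eval_width]. Qed.

Lemma eval_large vs i u : nth 0 vs i = u -> ev vs (large_expr i) = (u \in large a k).
Proof.
move=> iu; rewrite inE.
by apply: eval_ltn; [apply: eval_twice_budget | apply: eval_class_size].
Qed.

Lemma eval_unforced vs i u : nth 0 vs i = u ->
  ev vs (unforced_expr i) = (u \in unforced a k).
Proof.
move=> iu; rewrite inE; apply: eval_forall => w.
by apply: eval_imp; [apply: eval_large | apply: eval_not; apply: eval_nbr].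
Qed.

Lemma eval_has_unforced vs : ev vs has_unforced_expr = (unforced a k != set0).
Proof.
rewrite (eval_exists (p := mem (unforced a k))); last by move=> w; apply: eval_unforced.
by congr nat_of_bool; apply/existsP/set0Pn.
Qed.

Lemma eval_trimmed vs i u : nth 0 vs i = u ->
  ev vs (trimmed_expr i) = (u \in trimmed a k).
Proof.
move=> iu; rewrite inE; apply: eval_ltn (eval_width vs).
by apply: eval_rank => // w; rewrite inE; apply: eval_twin.
Qed.

Lemma eval_deg vs i u : nth 0 vs i = u -> ev vs (deg_expr i) = deg a setT u.
Proof.
move=> iu; apply: (eval_count (p := fun w => (w \in [set: 'I_n]) && a u w)) => w.
by rewrite inE; apply: eval_nbr.
Qed.

Lemma eval_deg_trimmed vs i u : nth 0 vs i = u ->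
  ev vs (deg_trimmed_expr i) = deg a (trimmed a k) u.
Proof.
move=> iu; apply: (eval_count (p := fun w => (w \in trimmed a k) && a u w)) => w.
by apply: eval_and; [apply: eval_trimmed | apply: eval_nbr].
Qed.

Lemma eval_maxdeg vs e (A : {set 'I_n}) :
  (forall vs' u, nth 0 vs' 0 = u -> ev vs' e = deg a A u) ->
  ev vs (maxdeg_expr e) = maxdeg a k A.
Proof.
move=> eA; have /minn_idPr <- := maxdeg_le_card a k A; rewrite card_ord -card_ord_ltn.
apply: eval_count => w; rewrite ltn_bigmax; apply: eval_exists => u.
by apply: eval_and; [apply: eval_large | apply: eval_ltn; last apply: eA].
Qed.

Lemma eval_shrink vs : ev vs shrink_expr = shrink a k (trimmed a k).
Proof.
have evT : ev vs (maxdeg_expr (deg_expr 0)) = maxdeg a k setT.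
  by apply: eval_maxdeg => vs' u; apply: eval_deg.
have evW : ev vs (maxdeg_expr (deg_trimmed_expr 0)) = maxdeg a k (trimmed a k).
  by apply: eval_maxdeg => vs' u; apply: eval_deg_trimmed.
by rewrite /shrink -evT -evW.
Qed.

Lemma eval_rep vs i u : nth 0 vs i = u -> ev vs (rep_expr i) = rep a u.
Proof.
move=> iu; have /minn_idPr <- := ltnW (ltn_ord (rep a u)); rewrite -card_ord_ltn.
rewrite (eval_count (p := fun w => [forall w', twin a u w' ==> (w < w')])).
  apply: eq_card => w; rewrite !inE; apply/forallP/idP => [/(_ (rep a u))|lt_w w'].
    by rewrite twin_rep.
  by apply/implyP => /rep_min; apply: leq_trans.
move=> w; apply: eval_forall => w'.
by apply: eval_imp; [apply: eval_twin | apply: eval_ltn].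
Qed.

Lemma eval_is_rep vs i u : nth 0 vs i = u -> ev vs (is_rep_expr i) = (rep a u == u).
Proof. by move=> iu; apply: eval_eqn; first apply: eval_rep. Qed.

Lemma eval_clique_rank vs i u : nth 0 vs i = u ->
  ev vs (clique_rank_expr i) = clique_rank a k u.
Proof.
move=> iu; apply: eval_rank => w; last exact: eval_rep.
rewrite inE; apply: eval_and; first exact: eval_is_rep.
by apply: eval_and; [apply: eval_isolated | apply: eval_eqn; apply: eval_capped_size].
Qed.

Lemma eval_kept vs i u : nth 0 vs i = u -> ev vs (kept_expr i) = (u \in kept a k).
Proof.
move=> iu; rewrite inE; apply: eval_and; first exact: eval_trimmed.
apply: eval_imp; first exact: eval_isolated.
by apply: eval_leq; [apply: eval_clique_rank | apply: eval_twice_budget].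
Qed.

Lemma eval_card_mixed vs : ev vs card_mixed_expr = #|mixed_reps a|.
Proof.
apply: eval_count => w; apply: eval_and; first exact: eval_is_rep.
exact/eval_not/eval_isolated.
Qed.

Lemma eval_accepted vs : ev vs accepted_expr = accepted I.
Proof.
apply: eval_and.
  by apply: eval_leq; [apply: eval_card_mixed | rewrite /= s_k; lia].
rewrite (eval_cond _ _ (eval_has_unforced vs)); case: ifP => _.
  by apply: eval_leq; [apply: eval_shrink | exact: s_eta].
apply: eval_forall => u; apply: eval_imp; first exact: eval_large.
apply: eval_forall => v; apply: eval_imp; first exact: eval_large.
apply: eval_leq; first exact: eval_deg.
by apply: eval_plus; [apply: eval_deg | apply: s_eta].
Qed.

Lemma eval_kernel_imbalance vs : ev vs kernel_imbalance_expr = kernel_imbalance I.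
Proof.
rewrite (eval_cond _ _ (eval_has_unforced vs)) /kernel_imbalance -(eval_shrink vs) -s_eta.
by case: ifP => _ //; apply: s_n.
Qed.

Lemma eval_card_kept vs : ev vs card_kept_expr = #|kept a k|.
Proof.
rewrite (eval_count (p := mem (kept a k))); last by move=> w; apply: eval_kept.
by apply: eq_card => w; rewrite inE.
Qed.

Lemma eval_kept_rank vs i u : nth 0 vs i = u ->
  ev vs (kept_rank_expr i) = rank (kept a k) u.
Proof. by move=> iu; apply: eval_rank => // w; apply: eval_kept. Qed.

Lemma eval_kernel_cell x y :
  ev [:: y; x] kernel_cell_expr = [exists u in kept a k, exists v in kept a k,
    (x * n + y == rank (kept a k) u * #|kept a k| + rank (kept a k) v) && adj G u v].
Proof.
apply: eval_exists => u; apply: eval_and; first exact: eval_kept.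
apply: eval_exists => v; apply: eval_and; first exact: eval_kept.
apply: eval_and; last exact: eval_adj.
apply: eval_eqn; first by rewrite eval_cell s_n.
apply: eval_plus; last exact: eval_kept_rank.
rewrite (eval_sum (F := fun w => if w \in kept a k then rank (kept a k) u else 0)).
  by rewrite -big_mkcond sum_nat_const mulnC.
by move=> w; rewrite (eval_cond _ _ (eval_kept (u := w) _)) // (eval_kept_rank (u := u)).
Qed.

End Evaluation.

(** * The program *)

Definition matrix_cell m (r : rel 'I_m) p : bool :=
  [exists i : 'I_m, exists j : 'I_m, (p == i * m + j) && r i j].

Lemma matrix_cell_ord m (r : rel 'I_m) (i j : 'I_m) : matrix_cell r (i * m + j) = r i j.
Proof.
apply/existsP/idP => [[i' /existsP[j' /andP[/eqP]]]|rij].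
  by case/cell_inj=> // /val_inj -> /val_inj ->.
by exists i; apply/existsP; exists j; rewrite eqxx.
Qed.

Lemma matrix_cell_induced m (G : graph 'I_m) (A : {set 'I_m}) p :
  matrix_cell (adj (induced G A)) p =
  [exists i in A, exists j in A, (p == rank A i * #|A| + rank A j) && adj G i j].
Proof.
apply/existsP/exists_inP => [[x /existsP[y]]|[i /enum_val_rank[x -> ->]]].
  rewrite adj_induced => xy; exists (enum_val x); first exact: enum_valP.
  by apply/exists_inP; exists (enum_val y); rewrite ?enum_valP ?rank_enum_val.
case/exists_inP=> j /enum_val_rank[y -> ->] xy.
by exists x; apply/existsP; exists y; rewrite adj_induced.
Qed.

Lemma input_stateP I : output_state (input_state I) I.
Proof. by split=> // i j; rewrite -[RHS]/(nat_of_bool _) -matrix_cell_ord. Qed.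

Lemma output_state_sets I r v s s' : output_state s I ->
  sets nglob r v s s' -> 2 < r -> output_state s' I.
Proof.
move=> [s0 s1 s2 mI] [_ m eq_regs] r2; split=> [|||i j]; last by rewrite m.
- by rewrite eq_regs //; lia.
- by rewrite eq_regs //; lia.
- by rewrite eq_regs //; lia.
Qed.

Definition stash_expr : expr := square_expr + cell_expr 1 0.

(* The kernel's matrix is first assembled at address n * n, as computing its     *)
(* entries takes the whole input, and is then moved to address 0.                *)
Definition kernel_program : cmd :=
  Seq (fill square_expr kernel_cell_expr)
    (Seq (fill (Lit 0) (Mem stash_expr))
       (Seq (assign 0 (Glob 4)) (assign 2 (Glob 5)))).

Definition star_program : cmd :=
  Seq (assign 0 (Lit 3)) (Seq (assign 1 (Lit 0)) (Seq (assign 2 (Lit 0))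
    (fill (Lit 0) star_expr))).

Definition program : cmd :=
  Seq (assign 3 accepted_expr) (Seq (assign 4 card_kept_expr)
    (Seq (assign 5 kernel_imbalance_expr) (If 3 kernel_program star_program))).

Definition time_kernel_program N : nat :=
  time_fill square_expr kernel_cell_expr N + (time_fill (Lit 0) (Mem stash_expr) N + 8).

Definition time_star_program : nat := 9 + time_fill (Lit 0) star_expr 3.

Definition time_program N : nat :=
  time accepted_expr N + 2 + (time card_kept_expr N + 2 +
    (time kernel_imbalance_expr N + 2 + (time_kernel_program N + time_star_program + 1))).

Lemma poly_bounded_program : poly_bounded time_program.
Proof.
rewrite /time_program /time_kernel_program.
by auto 20 using poly_bounded_time, poly_bounded_fill with poly_bounded.
Qed.

Lemma runs_star_program s :
  runs star_program s time_star_program (fun s' => output_state s' star_instance).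
Proof.
rewrite /time_star_program -[9]/(3 + (3 + 3)) -!addnA.
apply: runs_seq (@runs_assign 0 (Lit 3) s isT) _ => s1 [s1_0 _ _].
apply: runs_seq (@runs_assign 1 (Lit 0) s1 isT) _ => s2 [s2_1 _ regs2].
apply: runs_seq (@runs_assign 2 (Lit 0) s2 isT) _ => s3 [s3_2 _ regs3].
have s3_0 : regs s3 0 = 3 by rewrite regs3 // regs2.
have s3_1 : regs s3 1 = 0 by rewrite regs3.
have := @runs_fill s3 (Lit 0) star_expr 0 (matrix_cell star); rewrite s3_0 => run_fill.
apply: runs_weaken (run_fill _ _) => // [s4 [regs4 m4]|x y s4 x3 y3 _].
  split=> [|||i j] /=; rewrite ?regs4 //.
  by rewrite m4 s3_0 ltn_cell // subn0 matrix_cell_ord adj_star.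
rewrite -[x]/(val (Ordinal x3)) -[y]/(val (Ordinal y3)) matrix_cell_ord.
by apply: eval_not; apply: eval_eqb; apply: eval_eqn.
Qed.

Lemma runs_kernel_program I s : output_state s I ->
  regs s 4 = #|kept (nbr (igraph I)) (budget I)| -> regs s 5 = kernel_imbalance I ->
  runs kernel_program s (time_kernel_program (nverts I))
    (fun s' => output_state s' (kernel_instance I)).
Proof.
set n := nverts I; set A := kept _ _ => sI s_card s_imb.
have [s_n _ _ mI] := sI.
pose v p : nat := matrix_cell (adj (induced (igraph I) A)) p.
have stash_output p s1 : filled s (n * n) v p s1 -> output_state s1 I.
  case=> regs1 m1; split=> [|||i j]; rewrite ?regs1 //; try by case: sI.
  by rewrite m1 -mI leqNgt ltn_addr // ltn_cell.
have := @runs_fill s square_expr kernel_cell_expr (n * n) v; rewrite s_n => run_stash.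
apply: runs_seq (run_stash _ _) _ => [x y s1 _ _|x y s1 _ _|s1 s1_filled].
- by case/stash_output=> s1_n _ _ _; rewrite eval_square s1_n.
- by move/stash_output=> s1I; rewrite (eval_kernel_cell s1I) -matrix_cell_induced.
have [s1_n s1_k _ _] := stash_output _ _ s1_filled; have [regs1 m1] := s1_filled.
have := @runs_fill s1 (Lit 0) (Mem stash_expr) 0 v; rewrite s1_n => run_move.
apply: runs_seq (run_move _ _) _ => [//|x y s2 xn yn [regs2 m2]|s2 [regs2 m2]].
  have eval_stash : eval s2 [:: y; x] stash_expr = n * n + (x * n + y).
    have <- : regs s2 0 = n by rewrite regs2.
    by apply: eval_plus; [exact: eval_square | exact: eval_cell].
  rewrite -[LHS]/(memory s2 (eval s2 [:: y; x] stash_expr)) eval_stash m2 s1_n.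
  rewrite [_ < 0 + _]ltnNge leq_addr andbF m1 s_n.
  by rewrite addn0 leq_addr ltn_add2l ltn_cell // addKn.
rewrite -[8]/(4 + 4).
apply: runs_seq (@runs_assign 0 (Glob 4) s2 isT) _ => s3 [s3_0 m3 regs3].
apply: runs_weaken (@runs_assign 2 (Glob 5) s3 isT) => // s4 [s4_2 m4 regs4].
have card_le : #|A| <= n by have := max_card A; rewrite card_ord.
split=> [|||i j] /=.
- by rewrite regs4 // s3_0 /= regs2 // regs1.
- by rewrite regs4 // regs3 // regs2 // s1_k.
- by rewrite s4_2 /= regs3 // regs2 // regs1.
rewrite m4 m3 m2 s1_n /= subn0 /v matrix_cell_ord.
by rewrite (leq_trans (ltn_cell (ltn_ord i) (ltn_ord j))) // leq_mul.
Qed.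

Lemma runs_program I :
  runs program (input_state I) (time_program (nverts I))
    (fun s => output_state s (kernel I)).
Proof.
have s0I := input_stateP I; have s0_n : regs (input_state I) 0 = nverts I by [].
have := @runs_assign 3 accepted_expr (input_state I) isT.
rewrite s0_n (eval_accepted s0I) => run_accepted.
apply: runs_seq run_accepted _ => s1 s01; have s1I := output_state_sets s0I s01 isT.
have [s1_n _ _ _] := s1I; have := @runs_assign 4 card_kept_expr s1 isT.
rewrite s1_n (eval_card_kept s1I) => run_card.
apply: runs_seq run_card _ => s2 s12; have s2I := output_state_sets s1I s12 isT.
have [s2_n _ _ _] := s2I; have := @runs_assign 5 kernel_imbalance_expr s2 isT.
rewrite s2_n (eval_kernel_imbalance s2I) => run_imbalance.
apply: runs_seq run_imbalance _ => s3 s23; have s3I := output_state_sets s2I s23 isT.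
have [[s1_3 _ _] [s2_4 _ regs2] [s3_5 _ regs3]] := And3 s01 s12 s23.
have s3_3 : regs s3 3 = accepted I by rewrite regs3 // regs2.
have s3_4 : regs s3 4 = #|kept (nbr (igraph I)) (budget I)| by rewrite regs3.
apply: runs_if; rewrite s3_3 /kernel; case: (accepted I) => // _.
  exact: runs_kernel_program.
exact: runs_star_program.
Qed.

(** * Polynomial time *)

Lemma leq_bitlen x y : x <= y -> bitlen x <= bitlen y.
Proof. by move=> xy; rewrite ltnS leq_trunc_log. Qed.

Lemma bitlen_max x y : bitlen (maxn x y) <= bitlen x + bitlen y.
Proof. by case: (leqP x y) => _; rewrite ?leq_addr ?leq_addl. Qed.

Lemma isize_kernel I : isize (kernel I) <= 2 * isize I + 11.
Proof.
have n_le := nverts_kernel_le I.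
have n_bits := leq_trans (leq_bitlen n_le) (bitlen_max _ _).
have k_bits := leq_bitlen (budget_kernel I).
have eta_bits := leq_trans (leq_bitlen (imbalance_kernel I)) (bitlen_max _ _).
have bits3 : bitlen 3 = 2 by [].
have nn_le : nverts (kernel I) * nverts (kernel I) <= nverts I * nverts I + 9.
  by apply: leq_trans (leq_mul n_le n_le) _; nia.
rewrite /isize; lia.
Qed.

Lemma polytime_kernel : polytime_computable kernel.
Proof.
have [c [d time_le]] := poly_bounded_program.
exists program, (c + 11), d.+1 => I.
have [t [s [run_s t_le out]]] := runs_program I.
have n_lt : nverts I < isize I by rewrite /isize /bitlen; nia.
have size0 : 0 < isize I by apply: leq_trans n_lt.
have pow_le : isize I ^ d <= isize I ^ d.+1 by rewrite leq_pexp2l.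
have size_le : isize I <= isize I ^ d.+1 by rewrite -[X in X <= _]expn1 leq_pexp2l.
exists t, s; split=> //; last by apply: leq_trans (isize_kernel I) _; nia.
apply: leq_trans t_le (leq_trans (time_le _) _).
have : (nverts I).+1 ^ d <= isize I ^ d by case: (d) => // d'; rewrite leq_exp2r.
by nia.
Qed.

Theorem mainTheorem3 :
  exists f : instance -> instance,
    polytime_computable f /\
    exists C : nat, forall I : instance,
      [/\ yes_instance (f I) <-> yes_instance I,
          nverts (f I) <= C * (budget I ^ 3 + 1) &
          budget (f I) <= budget I].
Proof.
exists kernel; split; first exact: polytime_kernel.
exists 64 => I; split.
- exact: kernel_correct.
- exact: nverts_kernel.
- exact: budget_kernel.
Qed.
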